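(* Let $X$ be a real Banach space which is a predual of $\ell_1$, i.e. $X^*=\ell_1$ isometrically. Then the following are equivalent. (i) $\ell_1$ has the stable $\sigma(\ell_1,X)$-fixed point property. (ii) $\left(\mathrm{ext}\, B_{\ell_1}\right)'\subset r B_{\ell_1}$ for some $0\le r<1$.
   Context: $X^*$ is identified with $\ell_1$ via a fixed isometric isomorphism, and $\sigma(\ell_1,X)$ denotes the resulting $w^*$-topology on $\ell_1$. $B_{\ell_1}$ is the closed unit ball of $\ell_1$ and $\mathrm{ext}\,B_{\ell_1}$ is the set of its extreme points. For $A\subset X^*$, $\overline{A}^{*}$ is the $w^*$-closure of $A$, and $A'$ denotes the set of all $w^*$-limit points of $A$: $$A'=\left\{x^*\in X^*: x^*\in\overline{A\setminus\{x^*\}}^{*}\right\}.$$ A nonempty bounded closed convex subset $C$ of a Banach space has the fixed point property (fpp) if every nonexpansive mapping $T:C\to C$ (i.e. $\|T(x)-T(y)\|\le\|x-y\|$ for all $x,y\in C$) has a fixed point. A dual space $Y^*$ has the $\sigma(Y^*,Y)$-fixed point property if every nonempty, convex, $w^*$-compact (i.e. $\sigma(Y^*,Y)$-compact) subset of $Y^*$ has the fpp. A dual space $X^*$ has the stable $\sigma(X^*,X)$-fixed point property if there exists a real number $\gamma>1$ such that $Y^*$ has the $\sigma(Y^*,Y)$-fixed point property whenever $Y$ is a Banach space with $d(X,Y)<\gamma$, where $d(X,Y)$ is the Banach-Mazur distance, $d(X,Y)=\inf\{\|A\|\,\|A^{-1}\|\}$ over all isomorphisms $A$ from $X$ onto $Y$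 ($d(X,Y)=\infty$ if $X$ and $Y$ are not isomorphic). All Banach spaces are real. *)

(* Defs.v *)
From HB Require Import structures.
From mathcomp Require Import all_boot all_order all_algebra.
From mathcomp Require Import all_classical all_reals all_analysis.

Set Implicit Arguments.
Unset Strict Implicit.
Unset Printing Implicit Defensive.

Import Order.TTheory GRing.Theory Num.Theory.
Import numFieldNormedType.Exports.

Local Open Scope classical_set_scope.
Local Open Scope ring_scope.

Definition unit_ball (R : realType) (V : normedModType R) : set V :=
  [set x | `|x| <= 1].
Arguments unit_ball {R} V.

(* A real supremum: it is the operator norm only for bounded f (the library's
   [sup] is 0 on unbounded sets). *)
Definition opnorm (R : realType) (V W : normedModType R) (f : V -> W) : R :=
  sup [set `|f x| | x in unit_ball V].

Section opnorm_theory.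
Context (R : realType) (V W : normedModType R).

Lemma opnorm_has_sup (f : {linear V -> W}) : continuous f ->
  has_sup [set `|f x| | x in unit_ball V].
Proof.
move=> cf; split.
  by exists `|f 0|, 0 => //=; rewrite /unit_ball/= normr0.
have /linear_bounded_continuous/bounded_funP/(_ 1)[M fM] := cf.
by exists M => _ [x x1 <-]; exact: fM.
Qed.

Lemma le_opnorm (f : {linear V -> W}) : continuous f ->
  forall x, `|f x| <= opnorm f * `|x|.
Proof.
move=> cf x; have [->|x0] := eqVneq x 0; first by rewrite linear0 !normr0 mulr0.
have nx : 0 < `|x| by rewrite normr_gt0.
rewrite -ler_pdivrMr//.
apply: (sup_upper_bound (opnorm_has_sup cf)); exists (`|x|^-1 *: x).
  by rewrite /unit_ball/= normrZ normfV normr_id mulVf// gt_eqF.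
by rewrite linearZ/= normrZ normfV normr_id mulrC.
Qed.

Lemma opnorm_le (f : {linear V -> W}) (M : R) : 0 <= M ->
  (forall x, `|f x| <= M * `|x|) -> opnorm f <= M.
Proof.
move=> M0 fM; apply: ge_sup.
  by exists `|f 0|, 0 => //=; rewrite /unit_ball/= normr0.
move=> _ [x x1 <-]; apply: le_trans (fM x) _.
by rewrite -[leRHS]mulr1 ler_wpM2l.
Qed.

Lemma opnorm_ge0 (f : V -> W) : 0 <= opnorm f.
Proof.
rewrite /opnorm; set E := [set _ | _ in _].
have [hs|/sup_out ->//] := pselect (has_sup E).
apply: (@le_trans _ _ `|f 0|) => //; apply: (sup_upper_bound hs).
by exists 0 => //=; rewrite /unit_ball/= normr0.
Qed.

End opnorm_theory.

Section dual.
Context (R : realType) (X : normedModType R).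

Definition dual_pred : {pred X -> R^o} :=
  mem [set f : X -> R^o | linear f /\ continuous f].

Record dual := Dual { dual_val :> X -> R^o ; _ : dual_val \in dual_pred }.

HB.instance Definition _ := [isSub for dual_val].
HB.instance Definition _ := [Choice of dual by <:].

Lemma dual_submod_closed : submod_closed dual_pred.
Proof.
split.
  rewrite inE; split; last exact: cst_continuous.
  by move=> a x y; rewrite /= scaler0 addr0.
move=> a f g; rewrite !inE => -[lf cf] [lg cg]; split.
  move=> b x y; rewrite !fctE lf lg !scalerDr !scalerA mulrC.
  by rewrite -!addrA; congr (_ + _); rewrite addrCA.
by move=> x; apply: cvgD; [apply: cvgZr; exact: cf|exact: cg].
Qed.

HB.instance Definition _ :=
  GRing.isSubmodClosed.Build _ _ dual_pred dual_submod_closed.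
HB.instance Definition _ := [SubChoice_isSubLmodule of dual by <:].

Lemma dual_linear (f : dual) : linear f.
Proof. by have /[!inE] -[] := valP f. Qed.

Lemma dual_continuous (f : dual) : continuous f.
Proof. by have /[!inE] -[] := valP f. Qed.

HB.instance Definition _ (f : dual) :=
  GRing.isLinear.Build R X R^o *:%R f (@dual_linear f).

Lemma dual_ler_normD (f g : dual) :
  opnorm (f + g : dual) <= opnorm f + opnorm g.
Proof.
apply: opnorm_le; first by rewrite addr_ge0 ?opnorm_ge0.
move=> x; rewrite mulrDl; apply: le_trans (ler_normD _ _) _.
by rewrite lerD// le_opnorm//; exact: dual_continuous.
Qed.

Lemma dual_normrZ (l : R) (f : dual) :
  opnorm (l *: f : dual) = `|l| * opnorm f.
Proof.
have le1 (k : R) (g : dual) : opnorm (k *: g : dual) <= `|k| * opnorm g.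
  apply: opnorm_le; first by rewrite mulr_ge0 ?opnorm_ge0.
  move=> x; rewrite normrZ -mulrA ler_wpM2l// le_opnorm//.
  exact: dual_continuous.
apply/eqP; rewrite eq_le le1/=; have [->|l0] := eqVneq l 0.
  by rewrite normr0 mul0r opnorm_ge0.
rewrite -ler_pdivlMl ?normr_gt0// -normfV.
by have := le1 l^-1 (l *: f); rewrite scalerA mulVf// scale1r.
Qed.

Lemma dual_normr0_eq0 (f : dual) : opnorm f = 0 -> f = 0.
Proof.
move=> f0; apply/val_inj/funext => x; apply/eqP; rewrite -normr_le0.
by rewrite (le_trans (le_opnorm (@dual_continuous f) x))// f0 mul0r.
Qed.

HB.instance Definition _ := Lmodule_isNormed.Build R dual
  dual_ler_normD dual_normrZ dual_normr0_eq0.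

(* sigma(X^*, X): the initial topology for the evaluations at the points of X *)
Definition wstar : Type :=
  initial_topology (fun f : dual => (f : X -> R^o) : {ptws X -> R^o}).

HB.instance Definition _ := Topological.copy wstar
  (initial_topology (fun f : dual => (f : X -> R^o) : {ptws X -> R^o})).

End dual.

Section ell1.
Context (R : realType).

Definition ell1_pred : {pred nat -> R^o} :=
  mem [set a : nat -> R^o | cvgn [series `|a n|]_n].

Record ell1 := Ell1 { ell1_val :> nat -> R^o ; _ : ell1_val \in ell1_pred }.

HB.instance Definition _ := [isSub for ell1_val].
HB.instance Definition _ := [Choice of ell1 by <:].

Lemma ell1_submod_closed : submod_closed ell1_pred.
Proof.
split.
  rewrite inE /=; apply/cvg_ex; exists 0; rewrite (_ : series _ = cst 0).
    exact: cvg_cst.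
  by apply/funext => n; rewrite /series/= big1// => i _; rewrite normr0.
move=> l a b; rewrite !inE/= => ca cb.
apply: (@series_le_cvg R _ (`|l| *: (fun n => `|a n|) + (fun n => `|b n|))).
- by [].
- by move=> n; apply: addr_ge0 => //; apply: mulr_ge0.
- by move=> n; apply: le_trans (ler_normD _ _) _; rewrite normrZ.
- by apply: is_cvg_seriesD => //; exact: is_cvg_seriesZ.
Qed.

HB.instance Definition _ :=
  GRing.isSubmodClosed.Build _ _ ell1_pred ell1_submod_closed.
HB.instance Definition _ := [SubChoice_isSubLmodule of ell1 by <:].

Definition ell1_norm (a : ell1) : R := limn [series `|a n|]_n.

Lemma ell1_cvg (a : ell1) : cvgn [series `|a n|]_n.
Proof. by have /[!inE] := valP a. Qed.

Lemma ell1_ler_normD (a b : ell1) :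
  ell1_norm (a + b) <= ell1_norm a + ell1_norm b.
Proof.
rewrite /ell1_norm -limD; [|exact: ell1_cvg..].
apply: ler_lim; [exact: ell1_cvg|by apply: is_cvgD; exact: ell1_cvg|].
apply: nearW => n; rewrite /series/= fctE -big_split/=.
by apply: ler_sum => i _; exact: ler_normD.
Qed.

Lemma ell1_normrZ (l : R) (a : ell1) :
  ell1_norm (l *: a) = `|l| * ell1_norm a.
Proof.
rewrite /ell1_norm -[RHS]/(_ *: (limn _ : R^o)) -limZr; last exact: ell1_cvg.
congr (lim (_ @ \oo)); apply/funext => n; rewrite scalrfctE.
rewrite /series/= [RHS]mulr_sumr.
by apply: eq_bigr => i _; rewrite normrM.
Qed.

Lemma ell1_normr0_eq0 (a : ell1) : ell1_norm a = 0 -> a = 0.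
Proof.
move=> a0; apply/val_inj/funext => n; apply/eqP; rewrite -normr_le0 -a0.
have : [series `|a n|]_n n.+1 <= ell1_norm a.
  apply: nondecreasing_cvgn_le; last exact: ell1_cvg.
  by apply/nondecreasing_seqP => k; rewrite /series/= big_nat_recr//= lerDl.
apply: le_trans; rewrite /series/= big_nat_recr//= lerDr.
by apply: sumr_ge0.
Qed.

HB.instance Definition _ := Lmodule_isNormed.Build R ell1
  ell1_ler_normD ell1_normrZ ell1_normr0_eq0.

End ell1.

(* sigma(ell_1, X), transported along the identification J of ell_1 with X^* *)
Definition sigma_ell1 (R : realType) (X : normedModType R)
    (J : ell1 R -> dual X) : Type :=
  initial_topology (fun a : ell1 R => J a : wstar X).

HB.instance Definition _ (R : realType) (X : normedModType R)
    (J : ell1 R -> dual X) := Topological.copy (sigma_ell1 J)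
  (initial_topology (fun a : ell1 R => J a : wstar X)).

Definition isometric_iso (R : realType) (V W : normedModType R)
    (J : {linear V -> W}) : Prop :=
  bijective J /\ forall x, `|J x| = `|x|.

Definition ext (R : realType) (V : lmodType R) (C : set V) : set V :=
  [set x | C x /\ forall (y z : V) (t : R), C y -> C z -> 0 < t < 1 ->
    x = t *: y + (1 - t) *: z -> y = x /\ z = x].

Definition fpp (R : realType) (V : normedModType R) (C : set V) : Prop :=
  forall T : V -> V, set_fun C C T ->
    (forall x y, C x -> C y -> `|T x - T y| <= `|x - y|) ->
  exists2 x, C x & T x = x.

(* For complete Y, w*-compact sets are bounded and norm closed, so the sets C
   below are among those for which the fixed point property is considered. *)
Definition wstar_fpp (R : realType) (Y : normedModType R) : Prop :=
  forall C : set (dual Y), C !=set0 ->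
    convex_set (C : set (convex_lmodType (dual Y))) ->
    compact (C : set (wstar Y)) -> fpp C.

(* [ereal_inf set0 = +oo] covers non-isomorphic spaces. *)
Definition banach_mazur (R : realType) (X Y : normedModType R) : \bar R :=
  ereal_inf [set d | exists (A : {linear X -> Y}) (B : {linear Y -> X}),
    [/\ continuous A, continuous B, cancel A B, cancel B A &
        d = (opnorm A * opnorm B)%:E]].

Definition stable_wstar_fpp (R : realType) (X : completeNormedModType R) : Prop :=
  exists2 gamma : R, 1 < gamma &
    forall Y : completeNormedModType R,
      (banach_mazur X Y < gamma%:E)%E -> wstar_fpp Y.

(* Main.v *)
Require Import Defs.
From HB Require Import structures.
From mathcomp Require Import all_boot all_order all_algebra.
From mathcomp Require Import all_classical all_reals all_analysis.
From mathcomp Require Import ring lra.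

Set Implicit Arguments.
Unset Strict Implicit.
Unset Printing Implicit Defensive.

Import Order.TTheory GRing.Theory Num.Theory.
Import numFieldNormedType.Exports.

Local Open Scope classical_set_scope.
Local Open Scope ring_scope.

(** Throughout, e_k is the unit basis of ell1 and a vector f of X is read as the
bounded sequence of its values on the e_k. The extreme points of the unit ball
of ell1 are the vectors e_k and - e_k.

From the limit points to stability. If every limit point has norm at most r,
then the values of f on e_k are eventually at most r |f| + e in absolute value
([limit_point_tail]). Let v_i be a bounded family in ell1, let z be its
coordinatewise limit and x its weak* limit along an ultrafilter, and let rho be
the limit of |v_i - z|. The differences v_i - z move off to infinity, so
|v_i - y| tends to at least |z - y| + rho for every y ([ultra_norm_ge]), and
their weak* limit x - z has norm at most r rho ([ultra_wstar_coord_dist]).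
Suppose now that Y is isomorphic to X with distortion a b < 2 / (1 + r), and
that a nonexpansive self-map of a weak*-compact convex subset of Y^* has no
fixed point. A minimal invariant set K then has diameter d > 0 and is
diametral ([minimal_diametral]); as it is separable, it contains a sequence
x_n whose distance to every point of K tends to d ([diametral_sequence]). Along
an ultrafilter, transported to ell1, the mutual distances of the x_n give
2 rho <= a d, and their distances to the weak* limit, which lies in K, give
d <= b (1 + r) rho. Hence 2 d <= a b (1 + r) d < 2 d, a contradiction
([wstar_fpp_embedded]).

From stability to the limit points. If some limit point x0 has norm greater
than 1 - eps, then x0 is the weak* limit of vectors v_k = s_k e_(n_k) with
|s_k| = 1, where the coordinates of x0 along n_k are summably small
([extremal_sequence]). So x0, v_0, v_1, ... spans a copy of ell1 in X^* with
constant c = 1 - 3 eps ([combination_lower_bound]). Renorm X by the maximum of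
c |f| and sup_k |v_k f|: the distance to X is at most 1 / c, and in the new
dual norm the copy of ell1 becomes isometric ([adapted_isometry]). This last
fact is a duality statement, proved by extending a functional from X to pairs
of a vector and a convergent sequence, which splits it into a part controlled
by c |f| and a part in ell1. The convex combinations of x0, v_0, v_1, ... form
a weak*-compact set because v_k tends to x0, and on it the shift x0 -> v_0 ->
v_1 -> ... is an affine isometry without fixed point
([shifted_simplex_not_fpp]). *)
(** * Ultrafilter limits *)

Section ultrafilter_limits.
Context {T : Type} (U : set_system T) {UU : UltraFilter U}.

Lemma ultra_fmap (S : Type) (h : T -> S) : UltraFilter (h @ U).
Proof.
split; first exact: fmap_proper_filter.
move=> G PG UG; apply/seteqP; split => // A GA.
have [//|UnA] := in_ultra_setVsetC (h @^-1` A) UU.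
have /UG GnA : (h @ U) (~` A) by [].
have GAA : G (A `&` ~` A) by apply: filterI.
by have [x [Ax /(_ Ax)]] := filter_ex GAA.
Qed.

Lemma ultra_bounded_cvg (R : realType) (h : T -> R) (M : R) :
  (\forall i \near U, `|h i| <= M) -> exists l : R, h @ U --> l.
Proof.
move=> hM; have := @segment_compact R (- M) M; rewrite compact_ultra => /(_ _ (ultra_fmap h)).
case; last by move=> l [_ hl]; exists l.
by apply: filterS hM => i; rewrite ler_norml /= in_itv.
Qed.

End ultrafilter_limits.

(** Ultrafilters stand in for subsequences: one that refines F and contains A
exists as soon as A is met frequently along F. *)
Lemma ultra_of_frequently {T : Type} (F : set_system T) (A : set T) :
  Filter F -> (forall B, F B -> B `&` A !=set0) ->
  exists U : set_system T, [/\ UltraFilter U, F `<=` U & U A].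
Proof.
move=> FF FA.
have PF : ProperFilter (within A F).
  split; last exact: within_filter.
  by move=> A0; have [x [A0x Ax]] := FA _ A0; exact: A0x Ax.
have [U [UU sU]] := ultraFilterLemma PF.
exists U; split => //; last by apply: sU; exact: withinT.
by move=> B FB; apply: sU; apply: filterS FB => x Bx _.
Qed.

(** * The space ell1 *)

Section ell1_space.
Context {R : realType}.
Implicit Types (a b : ell1 R) (n N : nat).

Lemma ell1P a b : (forall n, a n = b n) -> a = b.
Proof. by move=> ab; apply/val_inj/funext. Qed.

Lemma ell1D a b n : (a + b) n = a n + b n. Proof. by []. Qed.
Lemma ell1B a b n : (a - b) n = a n - b n. Proof. by []. Qed.
Lemma ell1Z (l : R) a n : (l *: a) n = l * a n. Proof. by []. Qed.

Lemma ell1_sum (I : Type) (r : seq I) (P : pred I) (v : I -> ell1 R) n :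
  (\sum_(i <- r | P i) v i) n = \sum_(i <- r | P i) v i n.
Proof.
elim/big_rec2 : _ => // i x y Pi <-; exact: ell1D.
Qed.

Lemma ell1_psum_le a N : \sum_(i < N) `|a i| <= `|a|.
Proof.
have := @nondecreasing_cvgn_le R [series `|a n|]_n _ (@ell1_cvg R a) N.
rewrite /series /= big_mkord; apply.
by apply/nondecreasing_seqP => k; rewrite /series/= big_nat_recr//= lerDl.
Qed.

Lemma ell1_coord_le a n : `|a n| <= `|a|.
Proof.
apply: le_trans (ell1_psum_le a n.+1); rewrite big_ord_recr/= lerDr.
by apply: sumr_ge0.
Qed.

Lemma psum_bounded_ell1 (u : nat -> R) (M : R) :
  (forall N, \sum_(i < N) `|u i| <= M) ->
  exists2 a : ell1 R, (forall n, a n = u n) & `|a| <= M.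
Proof.
move=> uM.
have cu : cvgn [series `|u n|]_n.
  apply: nondecreasing_is_cvgn.
    by apply/nondecreasing_seqP => k; rewrite /series/= big_nat_recr//= lerDl.
  by exists M => _ [N _ <-]; rewrite /series /= big_mkord.
have uP : (u : nat -> R^o) \in @ell1_pred R by rewrite inE.
exists (Ell1 uP) => //.
apply: limr_le => //; apply: nearW => N.
by rewrite /series /= big_mkord.
Qed.

Lemma ell1_norm_le a (M : R) : (forall N, \sum_(i < N) `|a i| <= M) -> `|a| <= M.
Proof. by move=> /psum_bounded_ell1[b /ell1P ->]. Qed.

Lemma ell1_psum_cvg a : (fun N => \sum_(i < N) `|a i|) @ \oo --> `|a|.
Proof.
have := @ell1_cvg R a.
rewrite (_ : [series _]_n = (fun N => \sum_(i < N) `|a i|)); last first.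
  by apply/funext => N; rewrite /series /= big_mkord.
suff -> : `|a| = limn (fun N => \sum_(i < N) `|a i|) by [].
rewrite [LHS]/Num.norm /= /ell1_norm; congr (lim (_ @ \oo)).
by apply/funext => N; rewrite /series /= big_mkord.
Qed.

Lemma ell1_basis_ex n :
  exists2 a : ell1 R, (forall m, a m = (m == n)%:R) & `|a| <= 1.
Proof.
apply: psum_bounded_ell1 => N; under eq_bigr do rewrite normr_nat.
have [nN|Nn] := ltnP n N.
  rewrite (bigD1 (Ordinal nN))//= eqxx big1 ?addr0// => i.
  by rewrite -val_eqE /= => /negPf ->.
rewrite big1// => i _; rewrite (_ : _ == _ = false)//.
by apply/eqP => iE; have := ltn_ord i; rewrite iE ltnNge Nn.
Qed.

Definition ell1_basis n : ell1 R := projT1 (cid2 (ell1_basis_ex n)).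

Lemma ell1_basisE n m : ell1_basis n m = (m == n)%:R.
Proof. by rewrite /ell1_basis; case: cid2. Qed.

Lemma norm_ell1_basis n : `|ell1_basis n| = 1.
Proof.
apply/eqP; rewrite eq_le; apply/andP; split.
  by rewrite /ell1_basis; case: cid2.
have := ell1_coord_le (ell1_basis n) n.
by rewrite ell1_basisE eqxx normr1.
Qed.

Definition trunc N a : ell1 R := \sum_(i < N) a i *: ell1_basis i.

Lemma truncE N a n : trunc N a n = if (n < N)%N then a n else 0.
Proof.
rewrite /trunc ell1_sum; under eq_bigr do rewrite ell1Z ell1_basisE.
case: ltnP => nN.
  rewrite (bigD1 (Ordinal nN))//= eqxx mulr1 big1 ?addr0// => i.
  by rewrite -val_eqE /= eq_sym => /negPf ->; rewrite mulr0.
rewrite big1// => i _; rewrite (_ : _ == _ = false) ?mulr0//.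
by apply/eqP => iE; have := ltn_ord i; rewrite -iE ltnNge nN.
Qed.

Lemma norm_trunc N a : `|trunc N a| = \sum_(i < N) `|a i|.
Proof.
apply/eqP; rewrite eq_le; apply/andP; split.
  apply: le_trans (ler_norm_sum _ _ _) _; apply: ler_sum => i _.
  by rewrite normrZ norm_ell1_basis mulr1.
apply: le_trans (ell1_psum_le _ N); apply: ler_sum => i _.
by rewrite truncE ltn_ord.
Qed.

(** The norm of ell1 is additive over disjoint supports. *)
Lemma norm_tail N a : `|a - trunc N a| = `|a| - \sum_(i < N) `|a i|.
Proof.
apply/eqP; rewrite eq_le; apply/andP; split; last first.
  rewrite -norm_trunc lerBlDr; apply: le_trans (ler_normD _ _).
  by rewrite subrK.
apply: ell1_norm_le => M; rewrite lerBrDr.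
apply: le_trans (ell1_psum_le a (N + M)); rewrite big_split_ord /= [leLHS]addrC. rewrite lerD2l.
have : \sum_(i < M) `|(a - trunc N a) i| <= \sum_(i < N + M) `|(a - trunc N a) i|.
  by rewrite addnC big_split_ord /= lerDl; apply: sumr_ge0.
move=> /le_trans; apply; under [leLHS]eq_bigr do rewrite ell1B truncE.
rewrite big_split_ord /= big1 ?add0r => [|i _].
  by apply: ler_sum => i _; rewrite ltnNge leq_addr subr0.
by rewrite ltn_ord subrr normr0.
Qed.

Lemma tail_cvg a : (fun N => `|a - trunc N a|) @ \oo --> 0.
Proof.
under eq_fun do rewrite norm_tail.
have := cvgB (@cvg_cst _ (`|a| : R) _ \oo _) (@ell1_psum_cvg a).
by rewrite subrr; apply.
Qed.

Lemma tail_small a (e : R) : 0 < e -> exists N, `|a - trunc N a| < e.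
Proof.
move=> e0; have /cvgr_lt /(_ e e0) := tail_cvg a.
by move=> /filter_ex.
Qed.

End ell1_space.

(** * Limits of real functions along a filter *)

Lemma real_cvg_unique (R : realType) (T : Type) (F : set_system T)
    {FF : ProperFilter F} (u : T -> R) (l l' : R) :
  u @ F --> l -> u @ F --> l' -> l = l'.
Proof. exact: (cvg_unique (@norm_hausdorff _ R^o)). Qed.

Lemma real_cvg_le (R : realType) (T : Type) (F : set_system T)
    {FF : ProperFilter F} (u v : T -> R) (l l' : R) :
  u @ F --> l -> v @ F --> l' -> (\forall i \near F, u i <= v i) -> l <= l'.
Proof.
move=> ul vl' uv; rewrite -subr_ge0; apply: cvgr_to_ge (cvgB vl' ul) _.
by apply: filterS uv => i; rewrite -subr_ge0.
Qed.

(** * Duals and weak* convergence *)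

Section dual_space.
Context {R : realType} {X : normedModType R}.
Implicit Types (g h : dual X) (x : X).

Lemma dualP g h : (forall x, g x = h x) -> g = h.
Proof. by move=> gh; apply/val_inj/funext. Qed.

Lemma dualD g h x : (g + h) x = g x + h x. Proof. by []. Qed.
Lemma dualB g h x : (g - h) x = g x - h x. Proof. by []. Qed.
Lemma dualZ (l : R) g x : (l *: g) x = l * g x. Proof. by []. Qed.

Lemma dual_apply_le g x : `|g x| <= `|g| * `|x|.
Proof. exact: le_opnorm (@dual_continuous R X g) x. Qed.

Lemma dual_norm_le g (M : R) : 0 <= M ->
  (forall x, `|g x| <= M * `|x|) -> `|g| <= M.
Proof. by move=> M0 gM; exact: opnorm_le. Qed.

Lemma dual_norm_approx g (e : R) : 0 < e ->
  exists2 x, `|x| <= 1 & `|g| - e < g x.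
Proof.
move=> e0.
have [_ [x x1 <-] xe] := sup_adherent e0 (opnorm_has_sup (@dual_continuous R X g)).
have [gx0|gx0] := leP 0 (g x).
  by exists x => //; rewrite ger0_norm in xe.
exists (- x); first by rewrite normrN.
by rewrite linearN/=; rewrite ltr0_norm in xe.
Qed.

Lemma dual_norm_le1 g (M : R) :
  (forall x, `|x| <= 1 -> g x <= M) -> `|g| <= M.
Proof.
move=> gM; apply/ler_addgt0Pr => e e0.
have [x x1 xe] := dual_norm_approx g e0.
by rewrite -lerBlDr (le_trans (ltW xe))// gM.
Qed.

Lemma dual_of_bounded (phi : X -> R) (M : R) : 0 <= M ->
  (forall (l : R) x y, phi (l *: x + y) = l * phi x + phi y) ->
  (forall x, `|phi x| <= M * `|x|) ->
  exists2 g : dual X, (forall x, g x = phi x) & `|g| <= M.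
Proof.
move=> M0 lphi bphi.
have lin : linear (phi : X -> R^o) by move=> l x y; rewrite lphi.
pose f : {linear X -> R^o} := HB.pack (phi : X -> R^o) (GRing.isLinear.Build _ _ _ _ _ lin).
have fP : (f : X -> R^o) \in @dual_pred R X.
  rewrite inE /=; split; first exact: lin.
  apply: (@bounded_linear_continuous R X R^o f).
  apply: (@bounded_funP R X R^o f).1 => r; exists (M * r) => x xr.
  by apply: le_trans (bphi x) _; rewrite ler_wpM2l.
by exists (Dual fP) => //; exact: dual_norm_le.
Qed.

Lemma wstar_cvgP (T : Type) (F : set_system T) (v : T -> dual X) g : Filter F ->
  (v @ F --> (g : wstar X)) <-> forall x, v i x @[i --> F] --> g x.
Proof.
move=> FF; split=> [vg x|vg].
  have cg := @initial_continuous (dual X) {ptws X -> R^o}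
    (fun f : dual X => (f : X -> R^o)) g.
  have := cvg_comp _ _ vg cg.
  by move=> /(pointwise_cvgP _ _).1 /(_ x).
move=> A /= [_ [[B Bop <-] Bg sBA]].
have vg' : ((fun i => (v i : X -> R^o)) @ F) --> ((g : X -> R^o) : {ptws X -> R^o}).
  by apply: (pointwise_cvgP _ _).2 => x; exact: vg.
have : nbhs ((g : X -> R^o) : {ptws X -> R^o}) B by rewrite nbhsE; exists B.
move=> /vg' FB; apply: (@filterS _ F FF _ _ _ FB) => i Bi; exact: sBA.
Qed.

Lemma wstar_eval_continuous x : continuous (fun g : wstar X => (g : dual X) x : R^o).
Proof.
move=> g; have FF : Filter (nbhs (g : wstar X)) by exact: nbhs_filter.
by apply: ((@wstar_cvgP _ (nbhs (g : wstar X)) id g FF).1 _ x); exact: cvg_id.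
Qed.

Lemma wstar_hausdorff : hausdorff_space (wstar X).
Proof.
move=> g h gh; apply: dualP => x.
apply: (@norm_hausdorff _ R^o) => A B gA hB.
have /(_ _ gA)/= gA' := @wstar_eval_continuous x g.
have /(_ _ hB)/= hB' := @wstar_eval_continuous x h.
by have [k [kA kB]] := gh _ _ gA' hB'; exists ((k : dual X) x).
Qed.

(** The dual norm is a supremum of weak*-continuous functions, hence weak* lower
semicontinuous. *)
Lemma wstar_closed_ball h (s : R) :
  closed ([set g : dual X | `|g - h| <= s] : set (wstar X)).
Proof.
rewrite (_ : [set _ | _] = \bigcap_(x in [set x : X | `|x| <= 1])
   ((fun g : wstar X => (g : dual X) x : R^o) @^-1` [set y : R | y <= h x + s])).
  apply: closed_bigI => x _; apply: preimage_closed; last exact: closed_le.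
  by move=> g _; exact: wstar_eval_continuous.
apply/seteqP; split => [g /= gs x /= x1|g /= gs].
  rewrite -lerBlDl -dualB; apply: le_trans (ler_norm _) _.
  apply: le_trans (dual_apply_le _ _) _; apply: le_trans _ gs.
  by rewrite ler_piMr.
by apply: dual_norm_le1 => x x1; rewrite dualB lerBlDl; exact: gs.
Qed.

(** The compactness of dual balls in the form used here: the pointwise limit of a
bounded family along an ultrafilter is again a bounded functional. *)
Lemma wstar_alaoglu (T : Type) (U : set_system T) (v : T -> dual X) (M : R) :
  UltraFilter U -> (\forall i \near U, `|v i| <= M) ->
  exists2 g : dual X, `|g| <= M & forall x, v i x @[i --> U] --> g x.
Proof.
move=> UU vM.
have M0 : 0 <= M by have [i] := filter_ex vM; exact: le_trans.
have /choice[phi phiP] x : exists l : R, v i x @[i --> U] --> l.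
  apply: (@ultra_bounded_cvg _ _ _ _ _ (M * `|x|)).
  by apply: filterS vM => i vi; apply: le_trans (dual_apply_le _ _) _; exact: ler_wpM2r.
have [|x|g gphi gM] := @dual_of_bounded phi M M0.
- move=> l x y; have vD : v i (l *: x + y) @[i --> U] --> l * phi x + phi y.
    under eq_fun do rewrite linearP /=.
    by apply: cvgD => //; apply: cvgMl_tmp.
  exact: real_cvg_unique (phiP _) vD.
- have nv : `|v i x| @[i --> U] --> `|phi x| by exact: (@cvg_norm _ R^o).
  apply: cvgr_to_le nv _; apply: filterS vM => i vi.
  by apply: le_trans (dual_apply_le _ _) _; exact: ler_wpM2r.
- by exists g => // x; rewrite gphi.
Qed.

End dual_space.

(** * Extreme points of the unit ball of ell1 *)

Section ell1_extreme.
Context {R : realType}.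
Implicit Types (a b x y : ell1 R) (n N k : nat).

(** Only the coordinate k changes. This drives both the description of the
extreme points and, one basis vector at a time, the lower bound for the norm
of combinations of x0 and the v_k. *)
Lemma norm_add_basis x (t : R) k :
  `|x + t *: ell1_basis k| = `|x| - `|x k| + `|x k + t|.
Proof.
have c1 : (fun N => \sum_(i < N) `|x i| + (`|x k + t| - `|x k|)) @ \oo -->
    `|x| + (`|x k + t| - `|x k|).
  by apply: cvgD; [exact: ell1_psum_cvg|exact: cvg_cst].
rewrite -addrA [- _ + _]addrC.
apply: (real_cvg_unique (@ell1_psum_cvg _ _)).
apply: cvg_trans c1; apply: near_eq_cvg; near=> N.
have kN : (k < N)%N by near: N; exists k.+1.
rewrite (bigD1 (Ordinal kN) isT) [in RHS](bigD1 (Ordinal kN) isT).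
rewrite -[nat_of_ord (Ordinal kN)]/k ell1D ell1Z ell1_basisE eqxx mulr1.
rewrite [X in _ = _ + X](eq_bigr (fun i : 'I_N => `|x i|)); first by rewrite /=; ring.
move=> i ik; have {}ik : (i == k :> nat) = false by exact: negPf ik.
by rewrite ell1D ell1Z ell1_basisE ik mulr0 addr0.
Unshelve. all: by end_near. Qed.

Lemma ell1_basis_unique x (t : R) k : `|x| <= `|t| -> x k = t -> x = t *: ell1_basis k.
Proof.
move=> xt xkt; apply/eqP; rewrite -subr_eq0 -normr_le0 -scaleNr norm_add_basis.
by rewrite xkt subrr normr0 addr0 subr_le0.
Qed.

Lemma ext_ell1_basis k : ext (unit_ball (ell1 R)) (ell1_basis k).
Proof.
split; first by rewrite /unit_ball /= norm_ell1_basis.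
move=> y z t y1 z1 /andP[t0 t1] E.
have := congr1 (fun a : ell1 R => a k) E.
rewrite ell1D !ell1Z ell1_basisE eqxx /= => Ek.
have yk : y k <= 1 := le_trans (le_trans (ler_norm _) (ell1_coord_le y k)) y1.
have zk : z k <= 1 := le_trans (le_trans (ler_norm _) (ell1_coord_le z k)) z1.
have yk1 : y k = 1 by nra.
have zk1 : z k = 1 by nra.
by split; rewrite -[RHS]scale1r; apply: ell1_basis_unique => //; rewrite normr1.
Qed.

(** If a unit vector x had a coordinate with 0 < |x k| < 1, it would be the convex
combination, with weights |x k| and 1 - |x k|, of its normalised k-th part and
its normalised remainder. *)
Lemma ext_ell1P x : ext (unit_ball (ell1 R)) x ->
  exists s k, `|s| = 1 /\ x = s *: ell1_basis k.
Proof.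
case=> x1 extx; have e1 k : `|@ell1_basis R k| <= 1 by rewrite norm_ell1_basis.
have x0 : x != 0.
  apply/eqP => x0; have [||||e0 _] := extx (ell1_basis 0%N) (- ell1_basis 0%N) 2^-1.
  - exact: e1.
  - by rewrite /unit_ball /= normrN; exact: e1.
  - by apply/andP; split; lra.
  - by rewrite x0 scalerN -scalerBl (_ : 2^-1 - (1 - 2^-1) = 0) ?scale0r//; lra.
  - by have := @norm_ell1_basis R 0%N; rewrite e0 x0 normr0 => /eqP; rewrite eq_sym oner_eq0.
have nx0 : 0 < `|x| by rewrite normr_gt0.
have nx1 : `|x| = 1.
  apply/eqP; rewrite eq_le x1 leNgt; apply/negP => ltx1.
  have [||||_ z0] := extx (`|x|^-1 *: x) 0 `|x|.
  - by rewrite /unit_ball /= normrZ normfV normr_id mulVf// gt_eqF.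
  - by rewrite /unit_ball /= normr0.
  - by rewrite nx0 ltx1.
  - by rewrite scaler0 addr0 scalerA mulfV ?scale1r// gt_eqF.
  - by rewrite -z0 eqxx in x0.
have [k xk0] : exists k, x k != 0.
  apply: contrapT => /forallNP xz; move/eqP: x0; apply; apply: ell1P => k.
  by apply/eqP/negPn/negP => /xz.
exists (x k), k.
have xk1 : `|x k| <= 1 by rewrite -nx1 ell1_coord_le.
suff sk : `|x k| = 1.
  by split => //; apply: ell1_basis_unique; rewrite ?sk.
apply/eqP; rewrite eq_le xk1 leNgt; apply/negP => ltxk.
have sgn0 : `|x k| != 0 by rewrite normr_eq0.
have xk_gt0 : 0 < `|x k| by rewrite normr_gt0.
have [||||yx _] := extx ((x k / `|x k|) *: ell1_basis k)
   ((1 - `|x k|)^-1 *: (x + (- x k) *: ell1_basis k)) `|x k|.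
- by rewrite /unit_ball /= normrZ norm_ell1_basis mulr1 normf_div normr_id mulfV.
- rewrite /unit_ball /= normrZ norm_add_basis subrr normr0 addr0 nx1 normfV.
  by rewrite ger0_norm ?mulVf ?subr_eq0 1?eq_sym ?lt_eqF// subr_ge0 ltW.
- by rewrite xk_gt0 ltxk.
- rewrite !scalerA mulfV ?subr_eq0 1?eq_sym ?lt_eqF// scale1r mulrC divfK//.
  by rewrite scaleNr addrC subrK.
- have := congr1 (fun a : ell1 R => `|a|) yx.
  rewrite nx1 normrZ norm_ell1_basis mulr1.
  have := congr1 (fun a : ell1 R => a k) yx.
  rewrite ell1Z ell1_basisE eqxx mulr1 => -> xk_1.
  by rewrite xk_1 ltxx in ltxk.
Qed.

End ell1_extreme.

(** * Preduals of ell1 *)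

Section predual.
Context {R : realType} {X : normedModType R}.
Context (J : {linear ell1 R -> dual X}) (HJ : isometric_iso J).
Implicit Types (a b x y z : ell1 R) (f : X).
Notation e_ := (@ell1_basis R).

Lemma normJ a : `|J a| = `|a|. Proof. exact: HJ.2. Qed.

Lemma J_surj (g : dual X) : exists a, J a = g.
Proof. by have [[K _ KJ] _] := HJ; exists (K g). Qed.

Lemma J_inj a b : J a = J b -> a = b.
Proof. by have [[K JK _] _] := HJ => /(congr1 K); rewrite !JK. Qed.

Lemma J_apply_le a f : `|J a f| <= `|a| * `|f|.
Proof. by rewrite -normJ; exact: dual_apply_le. Qed.

Lemma J_trunc N a f : J (trunc N a) f = \sum_(k < N) a k * J (e_ k) f.
Proof.
rewrite /trunc linear_sum; elim/big_rec2 : _ => // k u v _ <-.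
by rewrite dualD linearZ.
Qed.

Lemma J_supported_le b f (s : R) : 0 <= s ->
  (forall k, b k != 0 -> `|J (e_ k) f| <= s) -> `|J b f| <= s * `|b|.
Proof.
move=> s0 bs; apply/ler_addgt0Pr => e e0.
have [N bN] := @tail_small _ b (e / (`|f| + 1)) (divr_gt0 e0 (ltr_wpDl (normr_ge0 f) ltr01)).
rewrite -{1}(subrK (trunc N b) b) addrC linearD dualD.
apply: le_trans (ler_normD _ _) _; apply: lerD.
  rewrite J_trunc; apply: le_trans (ler_norm_sum _ _ _) _.
  apply: le_trans _ (ler_wpM2l s0 (ell1_psum_le b N)); rewrite mulr_sumr.
  apply: ler_sum => k _; rewrite normrM mulrC.
  have [->|bk] := eqVneq (b k) 0; first by rewrite normr0 !mulr0.
  by apply: ler_wpM2r => //; exact: bs.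
apply: le_trans (J_apply_le _ _) _.
move: bN; rewrite ltr_pdivlMr ?ltr_wpDl// => /ltW; apply: le_trans.
by apply: ler_wpM2l => //; rewrite lerDl.
Qed.

Lemma sigma_cvgP (T : Type) (F : set_system T) (v : T -> ell1 R) a : Filter F ->
  (v @ F --> (a : sigma_ell1 J)) <-> forall f, J (v i) f @[i --> F] --> J a f.
Proof.
move=> FF; rewrite -[X in _ <-> X](wstar_cvgP _ _ FF); split=> [va|va].
  have ca := @initial_continuous (ell1 R) (wstar X) (fun a : ell1 R => J a : wstar X) a.
  exact: (cvg_comp _ _ va ca).
move=> A /= [_ [[B Bop <-] Ba sBA]].
have : nbhs (J a : wstar X) B by rewrite nbhsE; exists B.
by move=> /va FB; apply: (@filterS _ F FF _ _ _ FB) => i Bi; exact: sBA.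
Qed.

(** The values of f on the unit basis can accumulate only at values of limit
points of the extreme points: if they were frequently large, an ultrafilter
living on those indices would have, by compactness of the dual ball, a weak*
limit, which is such a limit point. *)
Lemma limit_point_tail (r : R) :
  limit_point (ext (unit_ball (ell1 R)) : set (sigma_ell1 J)) `<=`
    [set r *: a | a in unit_ball (ell1 R)] -> 0 <= r ->
  forall f (e : R), 0 < e ->
    exists N, forall k, (N <= k)%N -> `|J (e_ k) f| <= r * `|f| + e.
Proof.
move=> lp r0 f e e0; apply: contrapT => /forallNP nN.
pose A := [set k | r * `|f| + e < `|J (e_ k) f|].
have [|U [UU ooU UA]] := @ultra_of_frequently nat \oo A _.
  move=> B [N _ NB]; have /existsNP[k /not_implyP[Nk /negP]] := nN N.
  by rewrite -ltNge => kA; exists k; split => //; exact: NB.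
have [|g g1 eg] := @wstar_alaoglu _ _ _ U (fun k => J (e_ k)) 1 UU.
  by apply: filterE => k; rewrite normJ norm_ell1_basis.
have [a ag] := J_surj g.
have /lp[b b1 ba] : limit_point (ext (unit_ball (ell1 R)) : set (sigma_ell1 J)) a.
  move=> W aW.
  have UW : U [set k | W (e_ k)].
    have FU : Filter U by exact: (@filter_filter _ _ ultra_proper).
    by apply: ((sigma_cvgP e_ a FU).2 _ W aW); rewrite ag.
  have Une : U [set k | e_ k != a].
    have [[k eka]|na] := pselect (exists k, e_ k = a); last first.
      by apply: filterE => k /=; apply/eqP => eka; apply: na; exists k.
    apply: ooU; exists k.+1 => // m /= km; apply/eqP => ema.
    have := congr1 (fun x : ell1 R => x m) ema; rewrite -eka !ell1_basisE eqxx.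
    by rewrite gtn_eqF// => /eqP; rewrite oner_eq0.
  have [k [Wk ka]] := filter_ex (filterI UW Une).
  by exists (e_ k); split => //; exact: ext_ell1_basis.
have gf : `|g f| <= r * `|f|.
  rewrite -ag -ba linearZ dualZ normrM ger0_norm// ler_wpM2l//.
  by apply: le_trans (J_apply_le _ _) _; rewrite ler_piMl.
have nv : `|J (e_ k) f| @[k --> U] --> `|g f| by apply: (@cvg_norm _ R^o); exact: eg.
have : r * `|f| + e <= `|g f|.
  by apply: cvgr_to_ge nv _; apply: filterS UA => k /ltW.
by move=> /le_trans/(_ gf); rewrite gerDl leNgt e0.
Qed.

End predual.

(** * Coordinatewise limits along an ultrafilter *)

Lemma sum_cvg (R : realType) (T : Type) (F : set_system T) {FF : Filter F}
    (u : nat -> T -> R) (l : nat -> R) N :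
  (forall k, u k @ F --> l k) ->
  (fun i => \sum_(k < N) u k i) @ F --> \sum_(k < N) l k.
Proof.
move=> ul; elim: N => [|N IH].
  by under eq_fun do rewrite big_ord0; rewrite big_ord0; exact: cvg_cst.
by under eq_fun do rewrite big_ord_recr /=; rewrite big_ord_recr /=; exact: cvgD.
Qed.

Section asymptotic.
Context {R : realType} {T : Type} (U : set_system T) {UU : UltraFilter U}.
Context (v : T -> ell1 R) (M : R).
Hypothesis vM : \forall i \near U, `|v i| <= M.

Lemma ultra_coord_limit :
  exists2 z : ell1 R, (forall n, v i n @[i --> U] --> z n) & `|z| <= M.
Proof.
have /choice[u uP] n : exists l : R, v i n @[i --> U] --> l.
  apply: (@ultra_bounded_cvg _ _ _ _ _ M).
  by apply: filterS vM => i; apply: le_trans; exact: ell1_coord_le.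
have [N|z zu zM] := @psum_bounded_ell1 R u M; last by exists z => // n; rewrite zu.
have c : \sum_(k < N) `|v i k| @[i --> U] --> \sum_(k < N) `|u k|.
  apply: (@sum_cvg R T U _ (fun k i => `|v i k|) (fun k => `|u k|)) => k.
  by apply: (@cvg_norm _ R^o); exact: uP.
apply: cvgr_to_le c _; apply: filterS vM => i; apply: le_trans.
exact: ell1_psum_le.
Qed.

Lemma ultra_trunc_cvg0 (z : ell1 R) N : (forall n, v i n @[i --> U] --> z n) ->
  `|trunc N (v i - z)| @[i --> U] --> (0 : R).
Proof.
move=> vz; under eq_fun do rewrite norm_trunc.
have c : \sum_(k < N) `|(v i - z) k| @[i --> U] --> \sum_(k < N) `|z k - z k|.
  apply: (@sum_cvg R T U _ (fun k i => `|(v i - z) k|) (fun k => `|z k - z k|)) => k.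
  apply: (@cvg_norm _ R^o).
  by apply: (@cvgB _ R^o); [exact: vz|exact: cvg_cst].
by move: c; rewrite (eq_bigr (fun=> 0)) ?big1// => i _; rewrite subrr normr0.
Qed.

End asymptotic.

(** * Separability of ell1 *)

Section ell1_separable.
Context {R : realType}.

(** The dense sequence enumerates the finitely supported rational vectors. *)
Lemma ell1_separable : exists D : nat -> ell1 R,
  forall (a : ell1 R) (e : R), 0 < e -> exists n, `|a - D n| < e.
Proof.
pose comb (s : seq rat) : ell1 R :=
  \sum_(i < size s) (ratr (nth 0 s i) : R) *: ell1_basis i.
exists (fun n => if unpickle n is Some s then comb s else 0) => a e e0.
have e20 : 0 < e / 2 by rewrite divr_gt0.
have [N aN] := tail_small a e20.
pose d : R := e / 2 / N.+1%:R.
have d0 : 0 < d by rewrite divr_gt0.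
have /choice[q qP] i : exists q : rat, `|a i - ratr q| < d.
  have [|q] := @rat_in_itvoo R (a i - d) (a i + d); first by rewrite ltrBlDr -addrA ltrDl addr_gt0.
  by rewrite in_itv /= => qi; exists q; rewrite distrC ltr_distl.
exists (pickle (mkseq q N)); rewrite pickleK /comb size_mkseq.
rewrite -(subrK (trunc N a) a) -addrA (le_lt_trans (ler_normD _ _))//.
rewrite [ltRHS]splitr ltrD// /trunc -sumrB.
apply: (@le_lt_trans _ _ (\sum_(i < N) d)).
  apply: le_trans (ler_norm_sum _ _ _) _; apply: ler_sum => i _.
  rewrite nth_mkseq// -scalerBl normrZ norm_ell1_basis mulr1; exact: ltW.
rewrite sumr_const card_ord -[ltLHS]mulr_natl mulrA ltr_pdivrMr// mulrC.
by rewrite ltr_pM2l// ltr_nat.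
Qed.

End ell1_separable.

(** * Asymptotic behaviour of bounded families *)

Section ultra_asymptotic.
Context {R : realType}.
Implicit Types (a b x y z : ell1 R).

Lemma truncD N a b : trunc N (a + b) = trunc N a + trunc N b.
Proof. by apply: ell1P => n; rewrite ell1D !truncE; case: ifP; rewrite ?addr0. Qed.

Lemma norm_trunc_tail N a : `|trunc N a| + `|a - trunc N a| = `|a|.
Proof. by rewrite norm_tail norm_trunc addrC subrK. Qed.

(** Up to a small error z - y lives on a finite block of coordinates, on which
v i - z tends to 0. The two are thus asymptotically disjoint and their norms
add up. *)
Lemma ultra_norm_ge (T : Type) (U : set_system T) (v : T -> ell1 R) z (rho : R) :
  UltraFilter U -> (forall n, v i n @[i --> U] --> z n) ->
  `|v i - z| @[i --> U] --> rho ->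
  forall y (e : R), 0 < e -> \forall i \near U, `|z - y| + rho - e <= `|v i - y|.
Proof.
have aux (tv sv nv tz sz nz tw sw nw d rho' : R) : 0 < d ->
    tv + sv = nv -> tz + sz = nz -> tw + sw = nw -> tz - tw <= tv -> sw - sz <= sv ->
    tw < d -> rho' - d < nw -> sz < d -> nz + rho' - 8 * d <= nv by lra.
move=> UU vz vrho y e e0.
have e80 : 0 < e / 8 by rewrite divr_gt0.
have [N yN] := tail_small (z - y) e80.
have c0 : `|trunc N (v i - z)| @[i --> U] --> (0 : R) by exact: ultra_trunc_cvg0.
have rho_lt : rho - e / 8 < rho by rewrite ltrBlDr ltrDl.
have near0 := cvgr_lt _ c0 _ e80.
have nearrho := cvgr_gt _ vrho _ rho_lt.
near=> i.
have i1 : `|trunc N (v i - z)| < e / 8 by near: i; exact: near0.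
have i2 : rho - e / 8 < `|v i - z| by near: i; exact: nearrho.
have vE : v i - y = (v i - z) + (z - y) by rewrite addrA subrK.
have h1 : `|trunc N (z - y)| - `|trunc N (v i - z)| <= `|trunc N (v i - y)|.
  by rewrite vE (truncD N (v i - z)) [trunc N (v i - z) + _]addrC; exact: lerB_normD.
have h2 : `|(v i - z) - trunc N (v i - z)| - `|(z - y) - trunc N (z - y)|
    <= `|(v i - y) - trunc N (v i - y)|.
  by rewrite vE (truncD N (v i - z)) opprD addrACA; exact: lerB_normD.
have := aux _ _ _ _ _ _ _ _ _ _ _ e80 (norm_trunc_tail N (v i - y))
  (norm_trunc_tail N (z - y)) (norm_trunc_tail N (v i - z)) h1 h2 i1 i2 yN.
by rewrite mulrCA mulfV ?mulr1// pnatr_eq0.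
Unshelve. all: by end_near. Qed.

Section predual_asymptotic.
Context {X : normedModType R}.
Context (J : {linear ell1 R -> dual X}) (HJ : isometric_iso J) (r : R).
Hypothesis r0 : 0 <= r.
Hypothesis tailJ : forall (f : X) (e : R), 0 < e ->
  exists N, forall k, (N <= k)%N -> `|J (ell1_basis k) f| <= r * `|f| + e.

(** The difference v i - z leaves every finite block, and on the remaining basis
vectors f is at most r |f| up to a small error; so the weak* limit of v i - z
is at most r times the limit of the norms. *)
Lemma ultra_wstar_coord_dist (T : Type) (U : set_system T) (v : T -> ell1 R) x z (rho : R) :
  UltraFilter U -> (forall n, v i n @[i --> U] --> z n) ->
  `|v i - z| @[i --> U] --> rho ->
  (forall f, J (v i) f @[i --> U] --> J x f) ->
  `|x - z| <= r * rho.
Proof.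
move=> UU vz vrho vx.
have rho0 : 0 <= rho by apply: cvgr_to_ge vrho _; apply: filterE => i.
rewrite -(normJ HJ); apply: dual_norm_le => [|f]; first exact: mulr_ge0.
apply/ler_addgt0Pr => e e0.
have e'0 : 0 < e / (rho + 1) by rewrite divr_gt0// ltr_wpDl.
have [N fN] := tailJ f e'0; set s := r * `|f| + _ in fN.
have s0 : 0 <= s by apply: le_trans (fN N (leqnn N)).
have cl : `|J (v i - z) f| @[i --> U] --> `|J (x - z) f|.
  suff : (fun i => J (v i - z) f : R) @ U --> (J (x - z) f : R).
    by move=> h; apply: (@cvg_norm _ R^o); exact: h.
  have -> : (fun i => J (v i - z) f : R) = (fun i => J (v i) f - J z f).
    by apply/funext => i; rewrite linearB.
  have -> : J (x - z) f = J x f - J z f by rewrite linearB.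
  by apply: cvgB; [exact: vx|exact: cvg_cst].
have cr : `|trunc N (v i - z)| * `|f| + s * `|v i - z| @[i --> U] --> 0 * `|f| + s * rho.
  apply: cvgD; first by apply: cvgMr_tmp; exact: ultra_trunc_cvg0.
  exact: cvgMl_tmp.
have : `|J (x - z) f| <= 0 * `|f| + s * rho.
  apply: real_cvg_le cl cr _; apply: filterE => i.
  set w := v i - z.
  rewrite -{1}(subrK (trunc N w) w) [X in J X]addrC linearD dualD.
  apply: le_trans (ler_normD _ _) _; apply: lerD; first exact: J_apply_le.
  apply: le_trans (_ : s * `|w - trunc N w| <= _).
    apply: J_supported_le => // k; rewrite ell1B truncE.
    by case: ltnP => [|Nk _]; rewrite ?subrr ?eqxx//; exact: fN.
  by apply: ler_wpM2l => //; rewrite -(norm_trunc_tail N w) lerDr.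
move=> /le_trans; apply; rewrite mul0r add0r /s mulrDl.
rewrite mulrAC lerD2l mulrAC ler_pdivrMr ?ltr_wpDl//.
by rewrite ler_pM2l// lerDl.
Qed.

End predual_asymptotic.

End ultra_asymptotic.

(** * Minimal invariant sets *)

Section minimal_sets.
Context {R : realType} {Y : normedModType R}.
Implicit Types (K C : set (dual Y)) (x y w : dual Y).

Definition convex_comb_closed K :=
  forall x y (t : R), K x -> K y -> 0 <= t <= 1 -> K (t *: x + (1 - t) *: y).

Lemma convex_set_comb K :
  convex_set (K : set (convex_lmodType (dual Y))) -> convex_comb_closed K.
Proof.
move=> cK x y t Kx Ky t01.
have t01' : Itv.spec (@Itv.num_sem R) (Itv.Real `[0%Z, 1%Z]) t.
  rewrite /= /Itv.num_sem /= num_real /= in_itv /=.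
  by move: t01 => /andP[-> ->].
have := cK x y (Itv.mk t01'); rewrite !inE; exact.
Qed.

Variables (C : set (dual Y)) (T : dual Y -> dual Y).
Hypothesis C0 : C !=set0.
Hypothesis Ccvx : convex_comb_closed C.
Hypothesis Ccpt : compact (C : set (wstar Y)).
Hypothesis CT : set_fun C C T.

Definition admissible K := [/\ K !=set0, K `<=` C, closed (K : set (wstar Y)),
  convex_comb_closed K & set_fun K K T].

(** Zorn's lemma for the reverse inclusion; the intersection of a chain is nonempty
by weak* compactness. *)
Lemma minimal_admissible : exists K, admissible K /\
  forall K', admissible K' -> K' `<=` K -> K' = K.
Proof.
have Ccl : closed (C : set (wstar Y)).
  by apply: compact_closed Ccpt; exact: wstar_hausdorff.
(* The sets are encoded by their complements in C, so that unions of chains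
   encode intersections. *)
have [F FP Ftot|A [PA Amax]] := @Zorn_bigcup (dual Y) (fun A => admissible (C `\` A)).
  have E : C `\` \bigcup_(B in F) B = C `&` \bigcap_(B in F) (C `\` B).
    apply/seteqP; split=> [x [Cx nx]|x [Cx nx]].
      by split => // B FB; split => // Bx; apply: nx; exists B.
    by split => // -[B FB Bx]; have [] := nx B FB.
  rewrite E; split.
  - have [[B0 FB0]|nF] := pselect (F !=set0); last first.
      by have [x Cx] := C0; exists x; split => // B FB; case: nF; exists B.
    have FF : Filter (filter_from F (fun B => C `\` B)).
      apply: filter_from_filter; first by exists B0.
      move=> B B' FB FB'; have [BB|BB] := Ftot _ _ FB FB'.
        by exists B' => // x [Cx nBx]; split; split => // /BB.
      by exists B => // x [Cx nBx]; split; split => // /BB.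
    have PF : ProperFilter (filter_from F (fun B => C `\` B)).
      by apply: filter_from_proper => B /FP[].
    have [|x [Cx xcl]] := Ccpt PF; first by exists B0 => // x [].
    exists x; split => // B FB; have [_ _ clB _ _] := FP B FB.
    by apply: clB => W /xcl => xW; apply: xW; exists B.
  - by move=> x [].
  - apply: closedI => //; apply: closed_bigI => B /FP[] //.
  - move=> x y t [Cx nx] [Cy ny] t01; split; first exact: Ccvx.
    by move=> B FB; have [_ _ _ cB _] := FP B FB; apply: cB => //; [exact: nx|exact: ny].
  - move=> x [Cx nx]; split; first exact: CT.
    by move=> B FB; have [_ _ _ _ tB] := FP B FB; apply: tB; exact: nx.
exists (C `\` A); split => // K' aK' sK'.
apply/seteqP; split => // x [Cx nAx]; apply: contrapT => nK'x.
apply: (Amax (A `|` (C `\` K'))).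
  split=> [y|sub]; first by left.
  by apply: nAx; apply: sub; right.
rewrite (_ : C `\` _ = K') //; apply/seteqP; split => y.
  by move=> [Cy /not_orP[nAy nCK]]; apply: contrapT => nK'y; exact: nCK.
move=> K'y; have [Cy nAy] := sK' y K'y; split => //.
by move=> [//|[_ /(_ K'y)]].
Qed.

End minimal_sets.

(** * Diametral sets and sequences *)

Section diametral.
Context {R : realType} {Y : normedModType R}.
Implicit Types (K C : set (dual Y)) (x y w g : dual Y).

Lemma norm_comb_le x y w (t s s' : R) : 0 <= t <= 1 ->
  `|x - w| <= s -> `|y - w| <= s' ->
  `|t *: x + (1 - t) *: y - w| <= t * s + (1 - t) * s'.
Proof.
move=> /andP[t0 t1] xs ys'.
have -> : t *: x + (1 - t) *: y - w = t *: (x - w) + (1 - t) *: (y - w).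
  by rewrite !scalerBr addrACA -opprD -scalerDl addrCA subrr addr0 scale1r.
apply: le_trans (ler_normD _ _) _; rewrite !normrZ.
by rewrite ger0_norm// (@ger0_norm _ (1 - t)) ?subr_ge0// lerD// ler_wpM2l// subr_ge0.
Qed.

Lemma ball_comb_closed w (s : R) : convex_comb_closed [set g : dual Y | `|g - w| <= s].
Proof.
move=> x y t /= xs ys t01; apply: le_trans (norm_comb_le t01 xs ys) _.
by rewrite -mulrDl addrC subrK mul1r.
Qed.

(** The points y of K with K inside the ball of radius s around y form an
invariant set: for such a y, the part of K within s of T y is itself invariant,
hence all of K by minimality. So if one point of K has this property, all of
them do. *)
Lemma minimal_diametral C (T : dual Y -> dual Y) K :
  (forall x y, C x -> C y -> `|T x - T y| <= `|x - y|) ->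
  admissible C T K ->
  (forall K', admissible C T K' -> K' `<=` K -> K' = K) ->
  forall y0 (s : R), K y0 -> (forall w, K w -> `|y0 - w| <= s) ->
  forall y w, K y -> K w -> `|y - w| <= s.
Proof.
move=> Tne [K0 KC Kcl Kcvx KT] Kmin y0 s Ky0 y0s.
pose Ks := [set y | K y /\ forall w, K w -> `|y - w| <= s].
suff KsK : Ks = K by move=> y w; rewrite -{1}KsK => -[_]; exact.
apply: (Kmin); last by move=> y [].
split.
- by exists y0.
- by move=> y [/KC].
- rewrite (_ : Ks = K `&` \bigcap_(w in K) [set g : dual Y | `|g - w| <= s]).
    apply: closedI; first exact: Kcl.
    by apply: closed_bigI => w _; exact: wstar_closed_ball.
  by apply/seteqP; split.
- move=> x y t [Kx xs] [Ky ys] t01; split; first exact: Kcvx.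
  by move=> w Kw; exact: (@ball_comb_closed w s x y t (xs w Kw) (ys w Kw) t01).
- move=> y [Ky ys]; split; first exact: KT.
  pose K' := K `&` [set w | `|w - T y| <= s].
  suff K'K : K' = K by move=> w; rewrite -K'K distrC => -[].
  apply: (Kmin); last by move=> w [].
  split.
  + exists (T y0); split; first exact: KT.
    rewrite /= distrC; apply: le_trans (Tne _ _ _ _) _; try exact: KC.
    exact: ys.
  + by move=> w [/KC].
  + by apply: closedI; [exact: Kcl|exact: wstar_closed_ball].
  + move=> x w t [Kx xs] [Kw ws] t01; split; first exact: Kcvx.
    exact: (@ball_comb_closed (T y) s x w t xs ws t01).
  + move=> w [Kw ws]; split; first exact: KT.
    rewrite /= distrC; apply: le_trans (Tne _ _ _ _) _; try exact: KC.
    exact: ys.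
Qed.

(** A point at distance almost d from a convex combination of y 0, ..., y n is at
distance almost d from each of them, since no distance in K exceeds d; the
error is divided by the smallest weight. Density of the y i extends this to
every point of K. *)
Lemma diametral_sequence K (d : R) (y : nat -> dual Y) :
  convex_comb_closed K ->
  (forall x w, K x -> K w -> `|x - w| <= d) ->
  (forall x e, K x -> 0 < e -> exists2 w, K w & d - e < `|x - w|) ->
  (forall i, K (y i)) ->
  (forall g e, K g -> 0 < e -> exists i, `|y i - g| < e) ->
  exists2 x : nat -> dual Y, (forall n, K (x n)) &
    forall g e, K g -> 0 < e -> \forall n \near \oo, d - e <= `|x n - g|.
Proof.
move=> Kcvx Kd Kdiam Ky yd.
pose A := fix A n := if n is m.+1 then 2^-1 *: A m + (1 - 2^-1) *: y m.+1 else y 0%N.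
have h01 : 0 <= (2^-1 : R) <= 1 by apply/andP; split; lra.
have KA n : K (A n) by elim: n => [|n IH] /=; [exact: Ky|exact: Kcvx].
(* c n bounds from below the weight of each of y 0, ..., y n in A n; asking for
   distance d - c n ^ 2 to A n leaves an error c n after division by c n. *)
pose c n : R := 2^-1 ^+ n.+1.
have c0 n : 0 < c n by rewrite exprn_gt0// invr_gt0.
have cS n : c n.+1 = 2^-1 * c n by rewrite /c exprS.
have c1 n : c n <= 2^-1.
  by elim: n => [|n IH]; [rewrite /c expr1|rewrite cS; have := c0 n; lra].
have Ax n x i : K x -> (i <= n)%N -> `|A n - x| <= d - c n * (d - `|y i - x|).
  move=> Kx; elim: n i => [|n IH] i.
    rewrite leqn0 => /eqP ->; rewrite /A; have := Kd _ _ (Ky 0%N) Kx; have := c1 0%N.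
    by have := c0 0%N; move: `|_| => u; nra.
  have bi j := Kd _ _ (Ky j) Kx.
  rewrite leq_eqVlt => /orP[/eqP -> | ]; last rewrite ltnS => iN.
    have := norm_comb_le h01 (Kd _ _ (KA n) Kx) (lexx `|y n.+1 - x|).
    rewrite [A n.+1]/=; move=> /le_trans; apply.
    have := bi n.+1; have := c1 n.+1; have := c0 n.+1.
    by move: `|_| => u; nra.
  have := norm_comb_le h01 (IH i iN) (bi n.+1).
  rewrite [A n.+1]/=; move=> /le_trans; apply.
  by rewrite cS; move: (c n) `|_| => v u; lra.
have /choice[x xP] n : exists w, K w /\ d - c n * c n < `|A n - w|.
  by have [w Kw wd] := Kdiam (A n) (c n * c n) (KA n) (mulr_gt0 (c0 n) (c0 n)); exists w.
exists x => [n|g e Kg e0]; first by have [] := xP n.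
have [i yi] := yd g (e / 2) Kg (divr_gt0 e0 (ltr0n _ 2)).
have cc : c n @[n --> \oo] --> (0 : R).
  have -> : c = geometric 2^-1 2^-1 by apply/funext => n; rewrite /c exprS.
  by apply: cvg_geometric; rewrite ger0_norm//; lra.
have e20 : 0 < e / 2 by lra.
have ce := cvgr_lt _ cc _ e20.
near=> n.
have cn : c n < e / 2 by near: n; exact: ce.
have iN : (i <= n)%N by near: n; exists i.
have [Kx xn] := xP n.
have := Ax n (x n) i Kx iN.
have dn : d - c n < `|y i - x n|.
  have := Ax n (x n) i Kx iN; have := c0 n; move: xn.
  by move: `|_| `|_| (c n) => u v w; nra.
have : `|y i - x n| <= `|y i - g| + `|x n - g|.
  by rewrite [`|x n - g|]distrC -{1}(subrK g (y i)) -addrA ler_normD.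
move: dn yi cn; move: `|_| `|_| `|_| (c n) => u v w z; lra.
Unshelve. all: by end_near. Qed.

End diametral.

(** * Fixed points in duals close to ell1 *)

Section fixed_points.
Context {R : realType} {Y : completeNormedModType R}.

Lemma wstar_compact_bounded (C : set (dual Y)) :
  compact (C : set (wstar Y)) -> exists M, forall g, C g -> `|g| <= M.
Proof.
move=> Ccpt.
pose F : set (Y -> R^o) := [set f | exists2 g : dual Y, C g & f = (g : Y -> R^o)].
have [f [g Cg ->]|y|M FM] := @Banach_Steinhauss R Y R^o F _ _ 1.
- split; last exact: dual_linear.
  apply: (@bounded_funP R Y R^o g).2.
  apply: (@linear_bounded_continuous R Y R^o g).2; exact: dual_continuous.
- have cpt : compact ((fun g : wstar Y => (g : dual Y) y : R^o) @` C).
    apply: (@continuous_compact (wstar Y) R^o) Ccpt.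
    by apply/continuous_subspaceT/wstar_eval_continuous.
  have [M [_ MP]] := compact_bounded cpt.
  exists (M + 1) => _ [g Cg ->]; apply: MP; first by rewrite ltrDl.
  by exists g.
- exists M => g Cg; apply: dual_norm_le1 => x x1.
  by apply: le_trans (ler_norm _) _; apply: FM => //; exists g.
Qed.

Context (Phi : dual Y -> ell1 R) (a b r : R).
Hypothesis PhiB : forall g h, Phi (g - h) = Phi g - Phi h.
Hypothesis a0 : 0 <= a.
Hypothesis b0 : 0 <= b.
Hypothesis r0 : 0 <= r.
Hypothesis Phi_le : forall g, `|Phi g| <= a * `|g|.
Hypothesis Phi_ge : forall g, `|g| <= b * `|Phi g|.

(** Subsets of Y^* inherit separability from ell1: pick, whenever possible, a point
of K within 1 / (m + 1) of the n-th term of a dense sequence. *)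
Lemma embedded_dense_seq (K : set (dual Y)) : K !=set0 ->
  exists2 y : nat -> dual Y, (forall i, K (y i)) &
    forall g e, K g -> 0 < e -> exists i, `|y i - g| < e.
Proof.
move=> [g0 Kg0]; have [D DP] := @ell1_separable R.
have /choice[y yP] (p : nat * nat) : exists g, K g /\
    ((exists2 h, K h & `|Phi h - D p.1| < p.2.+1%:R^-1) -> `|Phi g - D p.1| < p.2.+1%:R^-1).
  have [[h Kh hD]|n] := pselect (exists2 h, K h & `|Phi h - D p.1| < p.2.+1%:R^-1).
    by exists h.
  by exists g0.
exists (fun i => if unpickle i is Some p then y p else g0) => [i|g e Kg e0].
  by case: unpickle => // p; have [] := yP p.
have e'0 : 0 < e / (2 * b + 1) by rewrite divr_gt0// ltr_wpDl// mulr_ge0.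
have [m me] := ltr_add_invr e'0; rewrite add0r in me.
have m0 : 0 < (m.+1%:R^-1 : R) by rewrite invr_gt0.
have [n gn] := DP (Phi g) _ m0.
exists (pickle (n, m)); rewrite pickleK.
have [_ /(_ (ex_intro2 _ _ g Kg gn)) yn] := yP (n, m).
apply: le_lt_trans (Phi_ge _) _; rewrite PhiB.
move: yn gn me; rewrite /=; set q := _^-1 => yn gn.
rewrite ltr_pdivlMr ?ltr_wpDl ?mulr_ge0// => me.
apply: le_lt_trans me; rewrite mulrDr mulr1.
have q0 : 0 <= q by rewrite invr_ge0.
apply: le_trans (_ : b * (q + q) <= _); last first.
  by rewrite (_ : q * (2 * b) = b * (q + q)) ?lerDl//; ring.
apply: ler_wpM2l => //; rewrite -(subrKA (D n)); apply: le_trans (ler_normD _ _) _.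
rewrite [X in _ + X]distrC; exact: lerD (ltW yn) (ltW gn).
Qed.

Hypothesis ab : a * b * (1 + r) < 2.
Hypothesis PhiW : forall (U : set_system nat) (v : nat -> dual Y) (g : dual Y) (z : ell1 R) (rho : R),
  UltraFilter U -> (forall y, v i y @[i --> U] --> g y) ->
  (forall n, Phi (v i) n @[i --> U] --> z n) -> `|Phi (v i) - z| @[i --> U] --> rho ->
  `|Phi g - z| <= r * rho.

(** Along the ultrafilter U, the distances within the sequence x give
2 rho <= a d, and the distances to its weak* limit g, a point of K, give
d <= b (rho + r rho). *)
Theorem wstar_fpp_embedded : wstar_fpp Y.
Proof.
move=> C C0 /convex_set_comb Ccvx Ccpt T CT Tne.
have [M CM] := wstar_compact_bounded Ccpt.
have [K [aK Kmin]] := minimal_admissible C0 Ccvx Ccpt CT.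
have [K0 KC Kcl Kcvx KT] := aK.
have [g0 Kg0] := K0.
pose E := [set s : R | exists x w, [/\ K x, K w & s = `|x - w|]].
have Esup : has_sup E.
  split; first by exists `|g0 - g0|, g0, g0.
  exists (M + M) => _ [x [w [/KC/CM xM /KC/CM wM ->]]].
  by apply: le_trans (ler_normB _ _) _; exact: lerD.
pose d := sup E.
have Kd x w : K x -> K w -> `|x - w| <= d.
  by move=> Kx Kw; apply: (sup_upper_bound Esup); exists x, w.
have [d_le0|d0] := leP d 0.
  exists g0; first exact: KC.
  apply/eqP; rewrite -subr_eq0 -normr_le0; apply: le_trans d_le0.
  by apply: Kd => //; exact: KT.
have Kdiam x e : K x -> 0 < e -> exists2 w, K w & d - e < `|x - w|.
  move=> Kx e0; apply: contrapT => nw.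
  have : d <= d - e; last by rewrite lerBrDl gerDr leNgt e0.
  apply: ge_sup; first by have [] := Esup.
  move=> _ [u [w [Ku Kw ->]]].
  apply: (minimal_diametral Tne aK Kmin Kx) => // w' Kw'.
  by rewrite leNgt; apply/negP => xw'; apply: nw; exists w'.
have [y Ky yd] := embedded_dense_seq K0.
have [x Kx xd] := diametral_sequence Kcvx Kd Kdiam Ky yd.
have [U [UU ooU]] := @ultraFilterLemma nat \oo _.
have Kcpt : compact (K : set (wstar Y)).
  exact: subclosed_compact Kcl Ccpt KC.
have [g [Kg xg]] : K `&` [set p : wstar Y | (x @ U : set_system (wstar Y)) --> p] !=set0.
  move: Kcpt; rewrite compact_ultra => /(_ _ (ultra_fmap (x : nat -> wstar Y))); apply.
  by have : U (x @^-1` K) by exact: filterE.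
have xM : \forall i \near U, `|Phi (x i)| <= a * M.
  by apply: filterE => i; apply: le_trans (Phi_le _) _; apply: ler_wpM2l => //; exact/CM/KC.
have [z xz _] := ultra_coord_limit xM.
have [rho xrho] : exists rho : R, `|Phi (x i) - z| @[i --> U] --> rho.
  apply: (@ultra_bounded_cvg _ _ _ _ _ (a * M + `|z|)).
  by apply: filterS xM => i; rewrite normr_id => xi; apply: le_trans (ler_normB _ _) _; rewrite lerD2r.
have gz : `|Phi g - z| <= r * rho.
  by apply: (PhiW UU _ xz xrho); exact: (wstar_cvgP x g _).1.
have xn n : `|Phi (x n) - z| + rho <= a * d.
  apply/ler_addgt0Pr => e e0.
  have h := ultra_norm_ge UU xz xrho (Phi (x n)) e0.
  have [i /= hi] := filter_ex h.
  move: hi; rewrite [`|z - _|]distrC lerBlDr => /le_trans; apply.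
  rewrite lerD2r -PhiB; apply: le_trans (Phi_le _) _; apply: ler_wpM2l => //.
  exact: Kd.
have rho2 : rho + rho <= a * d.
  have c : `|Phi (x n) - z| + rho @[n --> U] --> rho + rho by apply: cvgD => //; exact: cvg_cst.
  by apply: cvgr_to_le c _; apply: filterE.
have dle : d <= b * (rho + r * rho).
  apply/ler_addgt0Pr => e e0; rewrite -lerBlDr.
  have c : b * (`|Phi (x n) - z| + r * rho) @[n --> U] --> b * (rho + r * rho).
    by apply: cvgMl_tmp; apply: cvgD => //; exact: cvg_cst.
  apply: cvgr_to_ge c _; apply: filterS (ooU _ (xd g e Kg e0)) => n /le_trans; apply.
  apply: le_trans (Phi_ge _) _; apply: ler_wpM2l => //; rewrite PhiB.
  rewrite -(subrKA z); apply: le_trans (ler_normD _ _) _.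
  by rewrite lerD2l distrC.
have d1 : b * (rho + r * rho) * 2 <= a * b * (1 + r) * d.
  have -> : b * (rho + r * rho) * 2 = b * (1 + r) * (rho + rho) by ring.
  have -> : a * b * (1 + r) * d = b * (1 + r) * (a * d) by ring.
  by apply: ler_wpM2l => //; rewrite mulr_ge0// addr_ge0.
have : d * 2 < 2 * d.
  apply: le_lt_trans (_ : a * b * (1 + r) * d < _); last by rewrite ltr_pM2r.
  by apply: le_trans d1; rewrite ler_pM2r.
by rewrite mulrC ltxx.
Qed.

End fixed_points.

(** * Stability from the limit points *)

Section stability.
Context {R : realType} {X : completeNormedModType R}.
Context (J : {linear ell1 R -> dual X}) (HJ : isometric_iso J).

Lemma dual_pullback (Y : normedModType R) (A : {linear X -> Y}) : continuous A ->
  forall g : dual Y, exists x : ell1 R, forall f, J x f = g (A f).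
Proof.
move=> cA g.
have [||f|h hE _] := @dual_of_bounded R X (fun f => g (A f)) (`|g| * opnorm A).
- by rewrite mulr_ge0// opnorm_ge0.
- by move=> l u w; rewrite !linearP.
- apply: le_trans (dual_apply_le _ _) _; rewrite -mulrA ler_wpM2l//.
  exact: le_opnorm.
by have [x xh] := J_surj HJ h; exists x => f; rewrite xh hE.
Qed.

(** Composition with an isomorphism of X onto Y embeds Y^* into ell1 with constants
the two operator norms, and is continuous for the weak* topologies. *)
Lemma limit_points_stable (r : R) : 0 <= r < 1 ->
  limit_point (ext (unit_ball (ell1 R)) : set (sigma_ell1 J)) `<=`
    [set r *: a | a in unit_ball (ell1 R)] ->
  stable_wstar_fpp X.
Proof.
move=> /andP[r0 r1] lp; have r10 : 0 < 1 + r by rewrite ltr_wpDr.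
exists (2 / (1 + r)); first by rewrite ltr_pdivlMr// mul1r -[ltRHS]/(1 + 1) ltrD2l.
move=> Y /ereal_inf_lt[_ [A [B [cA cB AB BA ->]]]].
rewrite lte_fin ltr_pdivlMr// => ab.
have [Phi PhiE] := choice (dual_pullback cA).
apply: (@wstar_fpp_embedded R Y Phi (opnorm A) (opnorm B) r) => //.
- move=> g h; apply: (J_inj HJ); apply: dualP => f.
  by rewrite PhiE linearB !dualB !PhiE.
- exact: opnorm_ge0.
- exact: opnorm_ge0.
- move=> g; rewrite -(normJ HJ); apply: dual_norm_le => [|f].
    by rewrite mulr_ge0// opnorm_ge0.
  rewrite PhiE mulrAC [_ * `|g|]mulrC; apply: le_trans (dual_apply_le _ _) _.
  by rewrite ler_wpM2l//; exact: le_opnorm.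
- move=> g; apply: dual_norm_le => [|y]; first by rewrite mulr_ge0// opnorm_ge0.
  rewrite -{1}(BA y) -PhiE mulrAC [_ * `|Phi g|]mulrC.
  apply: le_trans (J_apply_le HJ _ _) _; rewrite ler_wpM2l//; exact: le_opnorm.
- move=> U v g z rho UU vg vz vrho.
  apply: (ultra_wstar_coord_dist HJ r0 (limit_point_tail HJ lp r0) UU vz vrho) => f.
  by rewrite PhiE; under eq_fun do rewrite PhiE; exact: vg.
Qed.

End stability.

(** * Pairing ell1 with bounded sequences *)

Section pairing_section.
Context {R : realType}.
Implicit Types (t b : ell1 R) (psi : nat -> R).

Definition bounded_seq psi (M : R) := forall k, `|psi k| <= M.

(** This limit is meaningful for bounded psi only, when the series converges
absolutely. *)
Definition pairing t psi : R := limn (fun N => \sum_(k < N) t k * psi k).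

Lemma pairing_cvg t psi M : bounded_seq psi M ->
  (fun N => \sum_(k < N) t k * psi k) @ \oo --> pairing t psi.
Proof.
move=> psiM.
have : cvgn (series (fun k => t k * psi k : R^o)).
  apply: normed_cvg; apply: (@series_le_cvg R _ (M *: (fun n => `|t n|))).
  - by move=> n; exact: normr_ge0.
  - by move=> n; rewrite mulr_ge0// (le_trans _ (psiM 0%N)).
  - move=> n; rewrite [leLHS](_ : _ = `|t n| * `|psi n|); last exact: normrM.
    by rewrite mulrC ler_wpM2r.
  - by apply: is_cvg_seriesZ; exact: ell1_cvg.
by rewrite /pairing /series /=; under [in X in X -> _]eq_fun do rewrite big_mkord.
Qed.

Lemma pairing_le t psi M : bounded_seq psi M -> `|pairing t psi| <= M * `|t|.
Proof.
move=> psiM; have M0 : 0 <= M by apply: le_trans (psiM 0%N).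
have c : `|\sum_(k < N) t k * psi k| @[N --> \oo] --> `|pairing t psi|.
  by apply: (@cvg_norm _ R^o); exact: (pairing_cvg psiM).
apply: cvgr_to_le c _; apply: filterE => N.
apply: le_trans (ler_norm_sum _ _ _) _.
apply: le_trans _ (ler_wpM2l M0 (ell1_psum_le t N)); rewrite mulr_sumr.
by apply: ler_sum => k _; rewrite normrM mulrC ler_wpM2r.
Qed.

Lemma pairing_linl (l : R) t b psi M : bounded_seq psi M ->
  pairing (l *: t + b) psi = l * pairing t psi + pairing b psi.
Proof.
move=> psiM; apply: (real_cvg_unique (pairing_cvg psiM)).
have -> : (fun N => \sum_(k < N) (l *: t + b) k * psi k) =
  (fun N => l * (\sum_(k < N) t k * psi k) + \sum_(k < N) b k * psi k).
  apply/funext => N; under [LHS]eq_bigr do rewrite ell1D ell1Z mulrDl -mulrA.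
  by rewrite big_split /= -mulr_sumr.
by apply: cvgD; [apply: cvgMl_tmp|]; exact: (pairing_cvg psiM).
Qed.

Lemma pairing_linr (l : R) t psi phi M M' : bounded_seq psi M -> bounded_seq phi M' ->
  pairing t (fun k => l * psi k + phi k) = l * pairing t psi + pairing t phi.
Proof.
move=> psiM phiM.
have bM : bounded_seq (fun k => l * psi k + phi k) (`|l| * M + M').
  move=> k; apply: le_trans (ler_normD _ _) _; apply: lerD => //.
  by rewrite normrM ler_wpM2l.
apply: (real_cvg_unique (pairing_cvg bM)).
have -> : (fun N => \sum_(k < N) t k * (l * psi k + phi k)) =
  (fun N => l * (\sum_(k < N) t k * psi k) + \sum_(k < N) t k * phi k).
  apply/funext => N; rewrite mulr_sumr -big_split /=; apply: eq_bigr => k _.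
  by rewrite mulrDr; congr (_ + _); rewrite mulrCA.
by apply: cvgD; [apply: cvgMl_tmp; exact: (pairing_cvg psiM)|exact: (pairing_cvg phiM)].
Qed.

Lemma pairing_trunc N t psi : pairing (trunc N t) psi = \sum_(k < N) t k * psi k.
Proof.
suff c : (fun n => \sum_(k < n) trunc N t k * psi k) @ \oo --> \sum_(k < N) t k * psi k.
  by apply/cvg_lim.
apply: cvg_near_cst; near=> n.
have Nn : (N <= n)%N by near: n; exists N.
rewrite -(subnKC Nn) big_split_ord /= [X in _ + X]big1 ?addr0 => [|i _].
  by apply: eq_bigr => i _; rewrite truncE ltn_ord.
by rewrite truncE ltnNge leq_addr mul0r.
Unshelve. all: by end_near. Qed.

Lemma pairing_basis k psi M : bounded_seq psi M -> pairing (ell1_basis k) psi = psi k.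
Proof.
move=> psiM; have -> : ell1_basis k = trunc k.+1 (@ell1_basis R k).
  apply: ell1P => n; rewrite truncE ell1_basisE ltnS.
  by have [->|nk] := eqVneq n k; [rewrite leqnn|rewrite if_same].
rewrite pairing_trunc big_ord_recr /= big1 ?add0r => [|i _].
  by rewrite ell1_basisE eqxx mul1r.
by rewrite ell1_basisE ltn_eqF ?mul0r.
Qed.

Lemma pairing_nonneg t : (forall k, 0 <= t k) -> pairing t (fun=> 1) = `|t|.
Proof.
move=> t0; have b1 : bounded_seq (fun=> 1 : R) 1 by move=> k; rewrite normr1.
apply: (real_cvg_unique (pairing_cvg b1)).
have -> : (fun N => \sum_(k < N) t k * 1) = (fun N => \sum_(k < N) `|t k|).
  by apply/funext => N; apply: eq_bigr => k _; rewrite mulr1 ger0_norm.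
exact: ell1_psum_cvg.
Qed.

Lemma ell1_cons_ex (s : R) t : exists2 b : ell1 R,
  (forall k, b k = if k is j.+1 then t j else s) & `|b| <= `|s| + `|t|.
Proof.
apply: psum_bounded_ell1 => -[|N]; first by rewrite big_ord0 addr_ge0.
by rewrite big_ord_recl /= lerD2l; exact: ell1_psum_le.
Qed.

(** With s = 0 this is the right shift of ell1. *)
Definition ell1_cons (s : R) t : ell1 R := projT1 (cid2 (ell1_cons_ex s t)).

Lemma ell1_consE s t k : ell1_cons s t k = if k is j.+1 then t j else s.
Proof. by rewrite /ell1_cons; case: cid2. Qed.

Lemma norm_ell1_cons s t : `|ell1_cons s t| = `|s| + `|t|.
Proof.
apply/eqP; rewrite eq_le; apply/andP; split.
  by rewrite /ell1_cons; case: cid2.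
have c : `|s| + \sum_(k < N) `|t k| @[N --> \oo] --> `|s| + `|t|.
  by apply: cvgD; [exact: cvg_cst|exact: ell1_psum_cvg].
apply: cvgr_to_le c _; apply: filterE => N.
apply: le_trans (ell1_psum_le _ N.+1); rewrite big_ord_recl /= ell1_consE lerD2l.
by apply: ler_sum => k _; rewrite ell1_consE.
Qed.

Lemma pairing_cons (x : R) t psi M : bounded_seq psi M ->
  pairing (ell1_cons x t) psi = x * psi 0%N + pairing t (fun k => psi k.+1).
Proof.
move=> psiM; have bS : bounded_seq (fun k => psi k.+1) M by move=> k; exact: psiM.
have c1 : \sum_(k < N.+1) ell1_cons x t k * psi k @[N --> \oo] --> pairing (ell1_cons x t) psi.
  have := pairing_cvg (t := ell1_cons x t) psiM.
  by rewrite -(cvg_shiftS (fun N => \sum_(k < N) ell1_cons x t k * psi k)).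
apply: (real_cvg_unique c1).
have -> : (fun N => \sum_(k < N.+1) ell1_cons x t k * psi k) =
    (fun N => x * psi 0%N + \sum_(k < N) t k * psi k.+1).
  apply/funext => N; rewrite big_ord_recl ell1_consE; congr (_ + _).
  by apply: eq_bigr => k _; rewrite ell1_consE.
by apply: cvgD; [exact: cvg_cst|exact: (pairing_cvg bS)].
Qed.

End pairing_section.

Section combination.
Context {R : realType} {Y : normedModType R} (u : nat -> dual Y).
Hypothesis u1 : forall k, `|u k| <= 1.

Lemma eval_bounded (y : Y) : bounded_seq (fun k => u k y) `|y|.
Proof. by move=> k; apply: le_trans (dual_apply_le _ _) _; rewrite ler_piMl. Qed.

Lemma combination_ex : exists S : ell1 R -> dual Y,
  forall t y, S t y = pairing t (fun k => u k y).
Proof.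
suff /choice[S SE] t : exists g : dual Y, forall y, g y = pairing t (fun k => u k y).
  by exists S.
have [||y|g gE _] := @dual_of_bounded R Y (fun y => pairing t (fun k => u k y)) `|t|.
- exact: normr_ge0.
- move=> l x y; rewrite -(pairing_linr _ _ (eval_bounded x) (eval_bounded y)).
  by congr pairing; apply/funext => k; rewrite linearP.
- by rewrite mulrC; apply: pairing_le; exact: eval_bounded.
- by exists g.
Qed.

Definition combination : ell1 R -> dual Y := projT1 (cid combination_ex).

Lemma combinationE t y : combination t y = pairing t (fun k => u k y).
Proof. by rewrite /combination; case: cid. Qed.

Lemma combination_lin (l : R) t b :
  combination (l *: t + b) = l *: combination t + combination b.
Proof.
apply: dualP => y; rewrite dualD dualZ !combinationE.
exact: pairing_linl (eval_bounded y).
Qed.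

Lemma combinationB t b : combination (t - b) = combination t - combination b.
Proof. by rewrite addrC -scaleN1r combination_lin scaleN1r addrC. Qed.

Lemma combination_le t : `|combination t| <= `|t|.
Proof.
apply: dual_norm_le => // y; rewrite combinationE mulrC.
by apply: pairing_le; exact: eval_bounded.
Qed.

End combination.

(** * Extension of dominated functionals along countably many directions *)

(** D v m stands for the inequality p v <= m between a sublinear functional p and
a real m. In this relational form p needs neither a formula nor to be finite
outside the span of the relevant vectors. As only countably many directions are
added, the one-dimensional extension step is iterated along the naturals. *)
Section countable_hahn_banach.
Context {R : realType} {X V : lmodType R} (i : X -> V) (z : X -> R).
Hypothesis i_lin : forall (l : R) x y, i (l *: x + y) = l *: i x + i y.
Hypothesis z_lin : forall (l : R) x y, z (l *: x + y) = l * z x + z y.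
Context (D : V -> R -> Prop) (d : nat -> V).
Hypothesis D_add : forall v v' m m', D v m -> D v' m' -> D (v + v') (m + m').
Hypothesis D_scale : forall v m (l : R), 0 <= l -> D v m -> D (l *: v) (l * m).
Hypothesis D_z : forall x m, D (i x) m -> z x <= m.
Hypothesis D_d : forall k, exists m, D (d k) m.
Hypothesis D_Nd : forall k, exists m, D (- d k) m.

Let dominated (ws : seq R) := forall x (a : nat -> R) m,
  D (i x + \sum_(k < size ws) a k *: d k) m ->
  z x + \sum_(k < size ws) a k * nth 0 ws k <= m.

Let dominated_rcons ws : dominated ws -> exists w, dominated (rcons ws w).
Proof.
move=> ws_dom; set n := size ws.
pose v x (a : nat -> R) := i x + \sum_(k < n) a k *: d k.
pose h x (a : nat -> R) := z x + \sum_(k < n) a k * nth 0 ws k.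
have vZD (l : R) x y a b : v (l *: x + y) (fun k => l * a k + b k) = l *: v x a + v y b.
  rewrite /v i_lin scalerDr addrACA; congr (_ + _).
  by rewrite scaler_sumr -big_split /=; apply: eq_bigr => k _; rewrite scalerDl scalerA.
have hZD (l : R) x y a b : h (l *: x + y) (fun k => l * a k + b k) = l * h x a + h y b.
  rewrite /h z_lin mulrDr addrACA; congr (_ + _).
  by rewrite mulr_sumr -big_split /=; apply: eq_bigr => k _; rewrite mulrDl mulrA.
have z0 : z 0 = 0 by have := z_lin (-1) 0 0; rewrite scaler0 addr0 mulN1r addNr.
have i0 : i 0 = 0 by have := i_lin (-1) 0 0; rewrite scaler0 addr0 scaleN1r addNr.
have v00 : v 0 (fun=> 0) = 0.
  by rewrite /v i0 add0r big1// => k _; rewrite scale0r.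
have h00 : h 0 (fun=> 0) = 0.
  by rewrite /h z0 add0r big1// => k _; rewrite mul0r.
have v_dom x a m : D (v x a) m -> h x a <= m by exact: ws_dom.
have vZ (l : R) x a : v (l *: x) (fun k => l * a k) = l *: v x a.
  have := vZD l x 0 a (fun=> 0); rewrite v00 !addr0 => <-.
  by congr v; apply/funext => k; rewrite addr0.
have hZ (l : R) x a : h (l *: x) (fun k => l * a k) = l * h x a.
  have := hZD l x 0 a (fun=> 0); rewrite h00 !addr0 => <-.
  by congr h; apply/funext => k; rewrite addr0.
(* The value on d n is the supremum of the lower bounds imposed by the
   inequalities at v x a - d n; the inequalities at v x a + d n bound it. *)
pose E := [set s | exists x a m, D (v x a - d n) m /\ s = h x a - m].
have Ebd x a m : D (v x a + d n) m -> forall s, E s -> s <= m - h x a.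
  move=> Dm _ [y [b [m' [Dm' ->]]]].
  have := D_add Dm Dm'; rewrite addrACA addrN addr0.
  rewrite -[v x a]scale1r -vZD => /v_dom; rewrite hZD mul1r.
  by move: (h x a) (h y b) => p q; lra.
have Esup : has_sup E.
  split.
    by have [m Dm] := D_Nd n; exists (h 0 (fun=> 0) - m), 0, (fun=> 0), m; rewrite v00 add0r.
  have [m Dm] := D_d n; exists (m - h 0 (fun=> 0)) => s; apply: Ebd.
  by rewrite v00 add0r.
exists (sup E) => x a m; rewrite size_rcons -/n => Dm.
rewrite big_ord_recr /= addrA -/(v x a) in Dm; rewrite big_ord_recr /=.
have -> : \sum_(k < n) a k * nth 0 (rcons ws (sup E)) k = \sum_(k < n) a k * nth 0 ws k.
  by apply: eq_bigr => k _; rewrite nth_rcons ltn_ord.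
rewrite nth_rcons ltnn eqxx addrA -/(h x a).
have [an0|an0|an0] := ltgtP (a n) 0.
- have c0 : 0 < (- a n)^-1 by rewrite invr_gt0 oppr_gt0.
  have := D_scale (ltW c0) Dm; rewrite scalerDr -vZ scalerA.
  rewrite invrN mulNr mulVf ?lt_eqF// scaleN1r => Dm'.
  have := sup_upper_bound Esup (ex_intro _ _ (ex_intro _ _ (ex_intro _ _ (conj Dm' erefl)))).
  rewrite -invrN hZ -mulrBr ler_pdivrMl ?oppr_gt0//.
  by move: (sup E) (h x a) (a n) => p q w; lra.
- have c0 : 0 < (a n)^-1 by rewrite invr_gt0.
  have := D_scale (ltW c0) Dm; rewrite scalerDr -vZ scalerA mulVf ?gt_eqF// scale1r => Dm'.
  have : sup E <= (a n)^-1 * (m - h x a).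
    by apply: ge_sup; [exact: Esup.1|move=> s /(Ebd _ _ _ Dm'); rewrite hZ mulrBr].
  rewrite ler_pdivlMl//.
  by move: (a n * sup E) (h x a) => p q; lra.
- by rewrite an0 mul0r addr0; apply: v_dom; rewrite an0 scale0r addr0 in Dm.
Qed.

Lemma countable_hahn_banach : exists w : nat -> R,
  forall N x (a : nat -> R) m, D (i x + \sum_(k < N) a k *: d k) m ->
    z x + \sum_(k < N) a k * w k <= m.
Proof.
have /choice[om omP] ws : exists w, dominated ws -> dominated (rcons ws w).
  have [/dominated_rcons[w wP]|n] := pselect (dominated ws); first by exists w.
  by exists 0.
pose W := fix W n := if n is m.+1 then rcons (W m) (om (W m)) else [::].
have sW n : size (W n) = n by elim: n => //= n IH; rewrite size_rcons IH.
have dW n : dominated (W n).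
  elim: n => [|n IH] /=; last exact: omP.
  by move=> x a m /=; rewrite !big_ord0 !addr0; exact: D_z.
exists (fun k => om (W k)) => N x a m.
have nW k : (k < N)%N -> nth 0 (W N) k = om (W k).
  elim: N => //= N IH; rewrite ltnS leq_eqVlt nth_rcons sW => /orP[/eqP ->|kN].
    by rewrite ltnn eqxx.
  by rewrite kN IH.
have := dW N x a m; rewrite sW => /[apply].
by under eq_bigr do rewrite nW//.
Qed.

End countable_hahn_banach.

(** * Sequences of extreme points converging to a limit point *)

Section extremal_sequences.
Context {R : realType} {X : normedModType R}.
Context (J : {linear ell1 R -> dual X}) (HJ : isometric_iso J).
Notation e_ := (@ell1_basis R).

(** Almost norming vectors for the terms of a dense sequence of ell1 already
separate ell1. *)
Lemma countable_separating : exists F : nat -> X,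
  forall x : ell1 R, (forall i, J x (F i) = 0) -> x = 0.
Proof.
have [D DP] := @ell1_separable R.
have /choice[F FP] i : exists f : X, `|f| <= 1 /\ `|D i| <= 2 * J (D i) f.
  have [->|Di] := eqVneq (D i) 0.
    by exists 0; rewrite !normr0 linear0 mulr0.
  have Di0 : 0 < `|D i| by rewrite normr_gt0.
  have [f f1] := dual_norm_approx (J (D i)) (divr_gt0 Di0 (ltr0n _ 2)).
  rewrite (normJ HJ) => h; exists f; split => //.
  by move: h; move: `|D i| (J (D i) f) => p q; lra.
exists F => x x0; apply/eqP; rewrite -normr_le0; apply/ler_addgt0Pr => e e0; rewrite add0r.
have e30 : 0 < e / 3 by rewrite divr_gt0.
have [i xi] := DP x _ e30; have [f1 fD] := FP i.
have h : J (D i) (F i) <= `|x - D i|.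
  rewrite -[J (D i) _]subr0 -(x0 i) -dualB -linearB distrC.
  apply: le_trans (ler_norm _) _; apply: le_trans (J_apply_le HJ _ _) _.
  by rewrite ler_piMr.
have : `|x| <= `|x - D i| + `|D i| by rewrite -{1}(subrK (D i) x) ler_normD.
move: fD xi h; move: `|x| `|x - D i| `|D i| (J _ _) => p q u w; lra.
Qed.

(** An ultrafilter converging to x0 and living on extreme points other than x0
cannot contain a singleton, so it avoids the finitely many extreme points
e_n and - e_n with n < N. *)
Lemma limit_point_far_basis (x0 : ell1 R) :
  limit_point (ext (unit_ball (ell1 R)) : set (sigma_ell1 J)) x0 ->
  forall (F : nat -> X) (K N : nat) (d : R), 0 < d ->
  exists (s : R) n, [/\ `|s| = 1, (N <= n)%N &
    forall i, (i < K)%N -> `|J (s *: e_ n) (F i) - J x0 (F i)| < d].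
Proof.
move=> lp F K N d d0.
have [|U [UU nU UA]] := @ultra_of_frequently _ (nbhs (x0 : sigma_ell1 J))
    [set x : ell1 R | ext (unit_ball (ell1 R)) x /\ x != x0] _.
  by move=> B /lp[y [yx0 exty By]]; exists y.
have FU : Filter U by exact: (@filter_filter _ _ ultra_proper).
have Uc f : J x f @[x --> U] --> J x0 f.
  by apply: ((sigma_cvgP J id x0 FU).1 _ f) => A /nU.
have Upt p : U [set x | x != p].
  have [//|Up] := in_ultra_setVsetC [set x | x != p] UU.
  have {}Up : U [set x | x = p] by apply: filterS Up => x /= /negP/negPn/eqP.
  have px0 : p = x0.
    apply: (J_inj HJ); apply: dualP => f; apply: (real_cvg_unique _ (Uc f)).
    by apply: cvg_near_cst; apply: filterS Up => x ->.
  have [x [xp [_]]] := filter_ex (filterI Up UA).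
  by rewrite xp px0 eqxx.
have UN : U [set x | forall n, (n < N)%N -> x != e_ n /\ x != - e_ n].
  elim: N => [|m IH]; first by apply: filterE => x n.
  apply: filterS (filterI IH (filterI (Upt (e_ m)) (Upt (- e_ m)))) => x [xm [x1 x2]] n.
  by rewrite ltnS leq_eqVlt => /orP[/eqP -> //|/xm].
have UK : U [set x | forall i, (i < K)%N -> `|J x (F i) - J x0 (F i)| < d].
  elim: K => [|k IH]; first by apply: filterE => x i.
  have Uk : U [set x | `|J x (F k) - J x0 (F k)| < d].
    have /cvgrPdist_lt /(_ _ d0) := Uc (F k).
    by apply: filterS => x /=; rewrite distrC.
  apply: filterS (filterI IH Uk) => x [xk x1] i.
  by rewrite ltnS leq_eqVlt => /orP[/eqP -> //|/xk].
have [x [[extx _] [xN xK]]] := filter_ex (filterI UA (filterI UN UK)).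
have [s [n [s1 xE]]] := ext_ell1P extx.
exists s, n; split => //; last by rewrite -xE.
rewrite leqNgt; apply/negP => /xN; rewrite xE.
have /eqP := s1; rewrite eqr_norml ler01 andbT => /orP[] /eqP ->.
  by rewrite scale1r eqxx => -[].
by rewrite scaleN1r eqxx => -[].
Qed.

(** Approximating x0 on finitely many vectors of a countable separating family at a
time gives convergence on that family; convergence at every f follows, as any
weak* limit of the sequence agrees with x0 on the family, hence equals x0.
Taking n k far out makes the coordinates of x0 along n summably small. *)
Lemma extremal_sequence (x0 : ell1 R) (eps : R) : 0 < eps ->
  limit_point (ext (unit_ball (ell1 R)) : set (sigma_ell1 J)) x0 ->
  exists (s : nat -> R) (n : nat -> nat), [/\ forall k, `|s k| = 1,
    forall k j, (k < j)%N -> (n k < n j)%N,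
    forall N, \sum_(k < N) `|x0 (n k)| <= eps &
    forall f, J (s k *: e_ (n k)) f @[k --> \oo] --> J x0 f].
Proof.
move=> eps0 lp; have [F Fsep] := countable_separating.
pose d k : R := k.+1%:R^-1.
have d0 k : 0 < d k by rewrite invr_gt0.
pose h k : R := eps * 2^-1 ^+ k.+1.
have h0 k : 0 < h k by rewrite mulr_gt0// exprn_gt0// invr_gt0.
have st (p : nat * nat) : exists q : R * nat, [/\ `|q.1| = 1, (p.2 <= q.2)%N,
    `|x0 q.2| <= h p.1 &
    forall i, (i < p.1)%N -> `|J (q.1 *: e_ q.2) (F i) - J x0 (F i)| < d p.1].
  have [M xM] := tail_small x0 (h0 p.1).
  have [s [n [s1 Mn sn]]] := limit_point_far_basis lp F p.1 (maxn M p.2) (d0 p.1).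
  exists (s, n); split => //=; first by apply: leq_trans Mn; exact: leq_maxr.
  apply: le_trans (ltW xM); apply: le_trans (ell1_coord_le _ n).
  by rewrite ell1B truncE ltnNge (leq_trans (leq_maxl M p.2) Mn) subr0.
have /choice[g gP] := st.
pose v := fix v k := if k is j.+1 then g (k, (v j).2.+1) else g (0%N, 0%N).
have vP k : [/\ `|(v k).1| = 1, `|x0 (v k).2| <= h k &
    forall i, (i < k)%N -> `|J ((v k).1 *: e_ (v k).2) (F i) - J x0 (F i)| < d k].
  by case: k => [|k] /=; [have [] := gP (0%N, 0%N)|have [] := gP (k.+1, (v k).2.+1)].
have vS k : ((v k).2 < (v k.+1).2)%N by have [_] := gP (k.+1, (v k).2.+1).
exists (fun k => (v k).1), (fun k => (v k).2); split.
- by move=> k; have [] := vP k.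
- by move=> k j; elim: j => // j IH; rewrite ltnS leq_eqVlt => /orP[/eqP ->//|/IH kj];
    exact: ltn_trans kj (vS j).
- move=> N; apply: (@le_trans _ _ (eps - eps * 2^-1 ^+ N)); last first.
    by rewrite gerBl mulr_ge0 ?ltW// exprn_gt0// invr_gt0.
  elim: N => [|N IH]; first by rewrite big_ord0 expr0 mulr1 subrr.
  rewrite big_ord_recr /=; have [_ + _] := vP N; rewrite /h !exprS.
  by move: IH; move: (\sum_(k < N) _) `|_| (2^-1 ^+ N) => p q w; nra.
move=> f; apply/cvgrPdist_lt => e e0.
apply: contrapT => nnear.
pose A := [set k | e <= `|J x0 f - J ((v k).1 *: e_ (v k).2) f|].
have [|U [UU ooU UA]] := @ultra_of_frequently nat \oo A _.
  move=> B ooB; apply: contrapT => nBA; apply: nnear; apply: filterS ooB => k Bk.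
  by rewrite ltNge; apply/negP => kA; apply: nBA; exists k.
have [|y y1 vy] := @wstar_alaoglu _ _ _ U (fun k => J ((v k).1 *: e_ (v k).2)) 1 UU.
  apply: filterE => k; rewrite (normJ HJ) normrZ norm_ell1_basis mulr1.
  by have [-> _ _] := vP k.
have [x xy] := J_surj HJ y.
have xx0 : x - x0 = 0.
  apply: Fsep => i; rewrite linearB dualB xy; apply/eqP; rewrite subr_eq0; apply/eqP.
  apply: (real_cvg_unique (vy (F i))); apply: (cvg_trans (cvg_app _ ooU)).
  apply/cvgrPdist_lt => e' e'0.
  have [m me] := ltr_add_invr e'0; rewrite add0r in me.
  near=> k; rewrite distrC.
  have ik : (i < k)%N by near: k; exists i.+1.
  have [_ _ /(_ i ik)] := vP k; move=> /lt_le_trans; apply; apply: le_trans (ltW me).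
  rewrite lef_pV2 ?posrE// ler_nat ltnS; near: k; by exists m.
have /cvgrPdist_lt /(_ _ e0) := vy f.
rewrite -xy -(subrK x0 x) xx0 add0r => nr.
have [k [/= kA]] := filter_ex (filterI UA nr).
by rewrite ltNge kA.
Unshelve. all: by end_near. Qed.

End extremal_sequences.

(** * Almost isometric copies of ell1 *)

Section lower_bound.
Context {R : realType} {X : normedModType R}.
Context (J : {linear ell1 R -> dual X}) (HJ : isometric_iso J).
Notation e_ := (@ell1_basis R).
Context (x0 : ell1 R) (eps : R) (s : nat -> R) (n : nat -> nat).
Hypothesis eps0 : 0 < eps.
Hypothesis x0_ge : 1 - eps <= `|x0|.
Hypothesis s1 : forall k, `|s k| = 1.
Hypothesis n_incr : forall k j, (k < j)%N -> (n k < n j)%N.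
Hypothesis x0_small : forall N, \sum_(k < N) `|x0 (n k)| <= eps.

(** The basis vectors e_(n k) are added one at a time. As the n k are distinct, the
coordinate n k of the partial sum comes from t 0 *: x0 only, so each step costs
at most 2 |t 0| |x0 (n k)|. *)
Lemma finite_lower_bound (t : ell1 R) N :
  (1 - 3 * eps) * \sum_(k < N.+1) `|t k| <=
    `|t 0%N *: x0 + \sum_(k < N) t k.+1 *: (s k *: e_ (n k))|.
Proof.
pose y N := t 0%N *: x0 + \sum_(k < N) t k.+1 *: (s k *: e_ (n k)).
have coord M j : (forall k, (k < M)%N -> n k <> j) -> y M j = t 0%N * x0 j.
  move=> nj; rewrite /y ell1D ell1Z ell1_sum big1 ?addr0// => k _.
  rewrite !ell1Z ell1_basisE (_ : (j == n k) = false) ?mulr0//.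
  by apply/eqP => jk; exact: (nj k).
have lb M : `|t 0%N| * `|x0| + \sum_(k < M) `|t k.+1| -
    2 * `|t 0%N| * (\sum_(k < M) `|x0 (n k)|) <= `|y M|.
  elim: M => [|M IH]; first by rewrite /y !big_ord0 !addr0 mulr0 subr0 normrZ.
  have -> : y M.+1 = y M + (t M.+1 * s M) *: e_ (n M).
    by rewrite /y big_ord_recr /= addrA scalerA.
  rewrite norm_add_basis coord; last first.
    by move=> k kM nkM; have := n_incr kM; rewrite nkM ltnn.
  have h : `|t M.+1| - `|t 0%N * x0 (n M)| <= `|t 0%N * x0 (n M) + t M.+1 * s M|.
    rewrite -[X in X - _]mulr1 -(s1 M) -normrM [X in _ <= `|X|]addrC.
    exact: lerB_normD.
  rewrite !big_ord_recr /=; move: IH h; rewrite normrM.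
  move: `|t 0%N| `|x0| (\sum_(k < M) `|t k.+1|) (\sum_(k < M) _) `|y M| => a b c d e.
  by move: `|x0 _| `|t M.+1| `|_ + _| => f g h; lra.
apply: le_trans (lb N); rewrite big_ord_recl /= .
have := x0_small N; have := sumr_ge0 (index_enum 'I_N) (F := fun k => `|t k.+1|) (P := xpredT).
move=> /(_ (fun k _ => normr_ge0 _)).
have := normr_ge0 (t 0%N); move: x0_ge.
move: `|t 0%N| `|x0| (\sum_(k < N) _) (\sum_(k < N) _) => a b c d.
by move: eps0 => ? ? ? ? ?; nra.
Qed.

(** The limit comes first and the sequence follows, so that the shift moves the
limit to the first term of the sequence. *)
Definition extremal_family k : dual X := if k is j.+1 then J (s j *: e_ (n j)) else J x0.

Hypothesis x0_le : `|x0| <= 1.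

Lemma extremal_family_le1 k : `|extremal_family k| <= 1.
Proof.
by case: k => [|k] /=; rewrite (normJ HJ)// normrZ norm_ell1_basis mulr1 s1.
Qed.

Lemma combination_lower_bound t : 3 * eps <= 1 ->
  (1 - 3 * eps) * `|t| <= `|combination extremal_family_le1 t|.
Proof.
move=> e3; apply/ler_addgt0Pr => e e0.
have e20 : 0 < e / 2 by rewrite divr_gt0.
have [N tN] := tail_small t e20.
have {}tN : `|t - trunc N.+1 t| < e / 2.
  apply: le_lt_trans tN; rewrite !norm_tail lerD2l lerN2 big_ord_recr /=.
  by rewrite lerDl.
set S := combination _.
have SB a b : S (a - b) = S a - S b by exact: combinationB.
have fin : S (trunc N.+1 t) = J (t 0%N *: x0 + \sum_(k < N) t k.+1 *: (s k *: e_ (n k))).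
  apply: dualP => f; rewrite combinationE pairing_trunc big_ord_recl /=.
  rewrite linearD linearZ dualD dualZ; congr (_ + _).
  rewrite linear_sum; elim/big_rec2 : _ => // i a b _ ->.
  have Jt : J (t i.+1 *: (s i *: e_ (n i))) = t i.+1 *: J (s i *: e_ (n i)).
    exact: linearZ.
  by rewrite dualD Jt dualZ add0n.
have h1 : (1 - 3 * eps) * `|trunc N.+1 t| <= `|S (trunc N.+1 t)|.
  by rewrite fin (normJ HJ) norm_trunc; exact: finite_lower_bound.
have h2 : `|S (trunc N.+1 t)| <= `|S t| + `|t - trunc N.+1 t|.
  rewrite -{1}(subKr t (trunc N.+1 t)) SB; apply: le_trans (ler_normB _ _) _.
  by rewrite lerD2l; exact: combination_le.
have := norm_trunc_tail N.+1 t; move: h1 h2 tN (normr_ge0 (t - trunc N.+1 t)).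
move: `|t| `|trunc _ t| `|S t| `|S _| `|_ - _| eps0 e3 => a b c d f g h; nra.
Qed.

End lower_bound.

(** * Equivalent renormings *)

Record renorming (R : realType) (X : completeNormedModType R) := Renorming {
  renorm :> X -> R;
  renorm_ratio : R;
  renormD : forall x y, renorm (x + y) <= renorm x + renorm y;
  renormZ : forall l x, renorm (l *: x) = `|l| * renorm x;
  renorm_ratio_gt0 : 0 < renorm_ratio;
  renorm_ge : forall x, renorm_ratio * `|x| <= renorm x;
  renorm_le : forall x, renorm x <= `|x| }.

(** An alias of X, to carry the new norm next to the old one. *)
Definition renormed (R : realType) (X : completeNormedModType R)
  (p : renorming X) : Type := X.

Section renormed_space.
Context {R : realType} {X : completeNormedModType R} (p : renorming X).

HB.instance Definition _ := GRing.Lmodule.copy (renormed p) X.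

Let renorm_eq0 (x : renormed p) : (p : X -> R) x = 0 -> x = 0.
Proof.
move=> px; apply/eqP; rewrite -(@normr_eq0 _ X) -normr_le0 normr_id.
by rewrite -(ler_pM2l (renorm_ratio_gt0 p)) mulr0 -px; exact: renorm_ge.
Qed.

HB.instance Definition _ := Lmodule_isNormed.Build R (renormed p)
  (@renormD _ _ p) (@renormZ _ _ p) renorm_eq0.

Lemma renormed_complete (F : set_system (renormed p)) :
  ProperFilter F -> cauchy F -> cvg F.
Proof.
move=> PF cF.
have p0 := renorm_ratio_gt0 p.
have [l Fl] : exists l : X, (F : set_system X) --> l.
  have cFX : cauchy (F : set_system X).
    apply: (@cauchy_exP R X) => e e0.
    have [x xF] := (@cauchyP R (renormed p) F PF).1 cF _ (mulr_gt0 p0 e0).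
    exists x; apply: filterS xF => y; rewrite -!ball_normE /= => xy.
    by rewrite -(ltr_pM2l p0); apply: le_lt_trans xy; exact: renorm_ge.
  by have /cvg_ex[l] := (@cauchy_cvgP X F PF).1 cFX; exists l.
apply/cvg_ex; exists (l : renormed p); apply/(@cvgrPdist_lt _ (renormed p)) => e e0.
have /cvgrPdist_lt /(_ _ e0) := Fl.
by apply: filterS => x; apply: le_lt_trans; exact: renorm_le.
Qed.

HB.instance Definition _ := Uniform_isComplete.Build (renormed p) renormed_complete.

End renormed_space.

(** * A renorming with an isometric copy of ell1 *)

(** Here u is a family of functionals of norm at most 1, with u 0 the weak* limit
of the others, that generates a copy of ell1 with constant c. The unit ball of
the dual for the norm max (c |f|) (sup_k |u k f|) is the hull of the image of
the ball of ell1 and of c times the dual ball of X. By the lower bound, the part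
of the latter in the span of u lies inside the former, so the dual norm is the
ell1 norm on that span. *)
Section exact_renorming.
Context {R : realType} {X : completeNormedModType R} (u : nat -> dual X) (c : R).
Hypothesis u1 : forall k, `|u k| <= 1.
Hypothesis u_cvg : forall f, u k.+1 f @[k --> \oo] --> u 0%N f.
Hypothesis c0 : 0 < c.
Hypothesis c1 : c <= 1.

Definition adapted_norm (f : X) : R :=
  Num.max (c * `|f|) (sup [set `|u k f| | k in setT]).

Lemma family_eval_le k f : `|u k f| <= `|f|.
Proof. by apply: le_trans (dual_apply_le _ _) _; rewrite ler_piMl. Qed.

Lemma adapted_norm_leP f (m : R) :
  (adapted_norm f <= m) <-> (c * `|f| <= m /\ forall k, `|u k f| <= m).
Proof.
have hs : has_sup [set `|u k f| | k in setT].
  by split; [exists `|u 0%N f|, 0%N|exists `|f| => _ [k _ <-]; exact: family_eval_le].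
rewrite /adapted_norm ge_max; split => [/andP[-> sm]|[-> um]].
  split => // k; apply: le_trans sm; apply: (sup_upper_bound hs).
  by exists k.
by apply: ge_sup; [exact: hs.1|move=> _ [k _ <-]].
Qed.

Lemma adapted_norm_ge f : c * `|f| <= adapted_norm f.
Proof. by have [] := (adapted_norm_leP f (adapted_norm f)).1 (lexx _). Qed.

Lemma adapted_norm_ge_u f k : `|u k f| <= adapted_norm f.
Proof. by have [_] := (adapted_norm_leP f (adapted_norm f)).1 (lexx _). Qed.

Lemma adapted_norm_le f : adapted_norm f <= `|f|.
Proof.
apply/adapted_norm_leP; split; first by rewrite ler_piMl.
by move=> k; exact: family_eval_le.
Qed.

Lemma adapted_normD f g : adapted_norm (f + g) <= adapted_norm f + adapted_norm g.
Proof.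
apply/adapted_norm_leP; split=> [|k].
  apply: le_trans (lerD (adapted_norm_ge f) (adapted_norm_ge g)).
  by rewrite -mulrDr ler_pM2l// ler_normD.
rewrite linearD; apply: le_trans (ler_normD _ _) _.
by apply: lerD; exact: adapted_norm_ge_u.
Qed.

Lemma adapted_normZ (l : R) f : adapted_norm (l *: f) = `|l| * adapted_norm f.
Proof.
have leZ (a : R) g : adapted_norm (a *: g) <= `|a| * adapted_norm g.
  apply/adapted_norm_leP; split=> [|k].
    by rewrite normrZ mulrCA ler_wpM2l// adapted_norm_ge.
  by rewrite linearZ /= normrM ler_wpM2l// adapted_norm_ge_u.
have n0 g : 0 <= adapted_norm g by apply: le_trans (adapted_norm_ge g); rewrite mulr_ge0// ltW.
apply/eqP; rewrite eq_le leZ /=; have [->|l0] := eqVneq l 0.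
  by rewrite normr0 mul0r.
by rewrite -ler_pdivlMl ?normr_gt0// -normfV -{1}(scalerK l0 f) leZ.
Qed.

Definition adapted_renorming : renorming X :=
  Renorming adapted_normD adapted_normZ c0 adapted_norm_ge adapted_norm_le.

Notation Y := (renormed adapted_renorming).

Lemma adapted_family_ex : exists U : nat -> dual Y,
  (forall k f, U k f = u k f) /\ forall k, `|U k| <= 1.
Proof.
have /choice[U UP] k : exists g : dual Y, (forall f, g f = u k f) /\ `|g| <= 1.
  have [||f|g gE g1] := @dual_of_bounded R Y (u k) 1.
  - exact: ler01.
  - by move=> l x y; exact: (dual_linear (u k)).
  - by rewrite mul1r; exact: adapted_norm_ge_u.
  - by exists g.
by exists U; split => k; have [] := UP k.
Qed.

Definition adapted_family : nat -> dual Y := projT1 (cid adapted_family_ex).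

Lemma adapted_familyE k f : adapted_family k f = u k f.
Proof. by rewrite /adapted_family; case: cid => U []. Qed.

Lemma adapted_family_le1 k : `|adapted_family k| <= 1.
Proof. by rewrite /adapted_family; case: cid => U []. Qed.

Notation SX := (combination u1).
Notation SY := (combination adapted_family_le1).

Lemma adapted_combinationE t f : SY t f = SX t f.
Proof.
by rewrite !combinationE; congr pairing; apply/funext => k; rewrite adapted_familyE.
Qed.

Hypothesis SX_ge : forall t, c * `|t| <= `|SX t|.

(** The duality behind the isometry. With P the dual norm of the combination of t,
this functional is dominated on X by P times the norm of the pair
(c f, (u k.+1 f)_k). It extends with the same bound to the span of these pairs and
of the pairs of 0 and an eventually constant sequence. The values of the
extension on the unit sequences are the terms of w of positive index; its value
on the constant sequence 1, minus their sum, is the term of index 0. The rest of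
the extension sees only c f, and is controlled by c |f|. *)
Lemma adapted_decomposition t : exists w : ell1 R,
  forall f, c * `|f| <= 1 -> SX (t - w) f + `|w| <= `|SY t|.
Proof.
set P := `|SY t|.
have P0 : 0 <= P by exact: normr_ge0.
pose V : lmodType R := (X * (nat -> R^o))%type.
pose i (f : X) : V := (f, fun k => u k.+1 f).
pose D (v : V) (m : R) := P * (c * `|v.1|) <= m /\ forall k, P * `|v.2 k| <= m.
pose d (k : nat) : V :=
  (0, fun j => if k is l.+1 then (j == l)%:R else 1).
have D_add v v' m m' : D v m -> D v' m' -> D (v + v') (m + m').
  move=> [v1 v2] [v1' v2']; split => [|k].
    apply: le_trans (lerD v1 v1'); rewrite -!mulrDr.
    by rewrite ler_wpM2l// ler_wpM2l ?ler_normD// ltW.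
  by apply: le_trans (lerD (v2 k) (v2' k)); rewrite -mulrDr ler_wpM2l// ler_normD.
have D_scale v m (l : R) : 0 <= l -> D v m -> D (l *: v) (l * m).
  move=> l0 [v1 v2]; split => [|k].
    rewrite normrZ (ger0_norm l0) (_ : P * _ = l * (P * (c * `|v.1|))) ?ler_wpM2l//.
    by ring.
  have -> : `|(l *: v).2 k| = l * `|v.2 k| by rewrite -{2}(ger0_norm l0) -normrM.
  by rewrite mulrCA ler_wpM2l.
have D_z f m : D (i f) m -> SY t f <= m.
  move=> [fm um]; apply: le_trans (ler_norm _) _.
  apply: le_trans (dual_apply_le _ _) _; rewrite -/P.
  have [P00|Pn0] := eqVneq P 0; first by rewrite P00 !mul0r in fm *.
  have Pgt0 : 0 < P by rewrite lt_neqAle eq_sym Pn0.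
  rewrite -ler_pdivlMl//; apply/adapted_norm_leP.
  have um' k : `|u k.+1 f| <= P^-1 * m.
    by rewrite ler_pdivlMl//; exact: um.
  split; first by rewrite ler_pdivlMl//; exact: fm.
  case=> [|k]; last exact: um'.
  have nc : `|u k.+1 f| @[k --> \oo] --> `|u 0%N f| by apply: (@cvg_norm _ R^o); exact: u_cvg.
  by apply: cvgr_to_le nc _; apply: filterE.
have d_le k j : `|(d k).2 j| <= 1.
  by case: k => [|l] /=; rewrite ?normr1// normr_nat; case: eqP.
have D_d k : exists m, D (d k) m.
  exists P; split => [|j]; first by rewrite normr0 !mulr0.
  by rewrite ler_piMr.
have D_Nd k : exists m, D (- d k) m.
  exists P; split => [|j]; first by rewrite normrN normr0 !mulr0.
  by rewrite [`|_|](_ : _ = `|(d k).2 j|) ?ler_piMr//; exact: normrN.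
have i_lin (l : R) x y : i (l *: x + y) = l *: i x + i y.
  by congr pair; apply/funext => k; rewrite (dual_linear (u k.+1)).
have z_lin (l : R) x y : SY t (l *: x + y) = l * SY t x + SY t y by exact: dual_linear.
have [w wP] := countable_hahn_banach i_lin z_lin D_add D_scale D_z D_d D_Nd.
(* w 0 is the value of the extension on the constant sequence 1, so om N is its
   value on the indicator of the indices k >= N. *)
pose om N := w 0%N - \sum_(k < N) w k.+1.
have sum1 (a : nat -> R) M : (\sum_(k < M) a k *: d k).1 = 0.
  elim: M => [|M IH]; first by rewrite big_ord0.
  rewrite big_ord_recr; transitivity ((\sum_(k < M) a k *: d k).1 + a M *: (0 : X)) => //.
  by rewrite IH scaler0 addr0.
have sum2 (a : nat -> R) N j :
    (\sum_(k < N.+1) a k *: d k).2 j = a 0%N + (if (j < N)%N then a j.+1 else 0).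
  elim: N => [|N IH].
    rewrite ltn0 addr0 big_ord_recr big_ord0.
    transitivity (0 + a 0%N * 1) => //.
    by rewrite add0r mulr1.
  rewrite big_ord_recr [LHS](_ : _ = (\sum_(k < N.+1) a k *: d k).2 j + a N.+1 * (j == N)%:R) //.
  rewrite IH -addrA; congr (_ + _); rewrite ltnS [(j <= N)%N]leq_eqVlt.
  have [->|jN] := eqVneq j N; first by rewrite ltnn add0r mulr1.
  by rewrite mulr0 addr0.
have alg (x y p q : R) : x + (p - y + (q - p - (x - y))) = q by ring.
have key N f (dl : R) : c * `|f| <= 1 -> 0 <= dl ->
    (forall k, (N <= k)%N -> `|u k.+1 f - u 0%N f| <= dl) ->
    SY t f - (om N * u 0%N f + \sum_(k < N) w k.+1 * u k.+1 f)
      + (`|om N| + \sum_(k < N) `|w k.+1|) <= P * (1 + dl).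
  move=> f1 dl0 fdl.
  (* The domination is tested on the sequence with values tau 1, ..., tau N and
     then approximately tau 0, where the signs tau are those of the extension;
     the coefficients a replace the values of f by these. *)
  pose tau k : R := if k is j.+1 then Num.sg (w j.+1) else Num.sg (om N).
  have tau1 k : `|tau k| <= 1.
    by case: k => [|k]; rewrite normr_sg; case: (_ != 0); rewrite ?ler01.
  pose a k : R := if k is j.+1 then tau j.+1 - tau 0%N - (u j.+1 f - u 0%N f)
    else tau 0%N - u 0%N f.
  have := wP N.+1 f a (P * (1 + dl)).
  have Dv : D (i f + \sum_(k < N.+1) a k *: d k) (P * (1 + dl)).
    split => [|j].
      rewrite [X in `|X|](_ : _ = f) ?ler_wpM2l ?(le_trans f1) ?lerDl//.
      by rewrite -[LHS]/(f + (\sum_(k < N.+1) a k *: d k).1) sum1 addr0.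
    rewrite ler_wpM2l// -[X in `|X|]/(u j.+1 f + (\sum_(k < N.+1) a k *: d k).2 j) sum2.
    case: ltnP => jN.
      rewrite [X in `|X|](_ : _ = tau j.+1) ?(le_trans (tau1 _)) ?lerDl//.
      exact: alg.
    rewrite addr0 [X in `|X|](_ : _ = tau 0%N + (u j.+1 f - u 0%N f)); last by rewrite /a addrCA.
    by apply: le_trans (ler_normD _ _) _; apply: lerD => //; exact: fdl.
  move=> /(_ Dv); apply: le_trans.
  rewrite -addrA lerD2l big_ord_recl /=.
  have -> : \sum_(k < N) a (bump 0 k) * w (bump 0 k) =
      \sum_(k < N) `|w k.+1| - \sum_(k < N) w k.+1 * u k.+1 f
      - (tau 0%N - u 0%N f) * \sum_(k < N) w k.+1.
    rewrite mulr_sumr -!sumrB; apply: eq_bigr => k _.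
    by rewrite /bump /= add1n [`|w k.+1|]normrEsg /a /tau; ring.
  rewrite [`|om N|]normrEsg -/(tau 0%N) /om.
  move: (\sum_(k < N) `|_|) (\sum_(k < N) w _ * _) (\sum_(k < N) _) => p q r.
  by rewrite le_eqVlt; apply/orP; left; apply/eqP; rewrite /a; ring.
have u0 k : u k 0 = 0 by rewrite linear0.
have bnd N : `|om N| + \sum_(k < N) `|w k.+1| <= P.
  have f1 : c * `|0 : X| <= 1 by rewrite normr0 mulr0.
  have d0 k : (N <= k)%N -> `|u k.+1 0 - u 0%N 0| <= 0.
    by rewrite !u0 subrr normr0.
  have S0 : om N * u 0%N 0 + \sum_(k < N) w k.+1 * u k.+1 0 = 0.
    by rewrite u0 mulr0 add0r big1// => k _; rewrite u0 mulr0.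
  have t0 : SY t (0 : X) = 0 by exact: (linear0 (SY t)).
  by have := key N 0 0 f1 (lexx 0) d0; rewrite S0 t0 subrr add0r addr0 mulr1.
have [N|b bE bP] := @psum_bounded_ell1 R (fun k => w k.+1) P.
  by apply: le_trans (bnd N); rewrite lerDr.
have b1 : bounded_seq (fun=> 1 : R) 1 by move=> k; rewrite normr1.
pose sg := pairing b (fun=> 1).
have om_cvg : om N @[N --> \oo] --> w 0%N - sg.
  have -> : om = (fun N => w 0%N - \sum_(k < N) b k * 1).
    by apply/funext => N; congr (_ - _); apply: eq_bigr => k _; rewrite mulr1 bE.
  by apply: cvgB; [exact: cvg_cst|exact: (pairing_cvg b1)].
exists (ell1_cons (w 0%N - sg) b) => f f1.
have uf : bounded_seq (fun k => u k f) `|f| by move=> k; exact: family_eval_le.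
have ufS : bounded_seq (fun k => u k.+1 f) `|f| by move=> k; exact: family_eval_le.
have L : SY t f - (om N * u 0%N f + \sum_(k < N) b k * u k.+1 f)
      + (`|om N| + \sum_(k < N) `|b k|) @[N --> \oo] -->
    SX (t - ell1_cons (w 0%N - sg) b) f + `|ell1_cons (w 0%N - sg) b|.
  rewrite (combinationB u1) dualB [X in _ - X](combinationE u1) (pairing_cons _ _ uf).
  rewrite norm_ell1_cons -adapted_combinationE.
  apply: cvgD.
    apply: cvgB; first exact: cvg_cst.
    by apply: cvgD; [exact: cvgMr_tmp|exact: (pairing_cvg ufS)].
  by apply: cvgD; [apply: (@cvg_norm _ R^o)|exact: ell1_psum_cvg].
apply/ler_addgt0Pr => e e0.
have P1 : 0 < P + 1 by rewrite ltr_wpDl.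
have e'0 : 0 < e / (P + 1) by rewrite divr_gt0.
apply: (@le_trans _ _ (P * (1 + e / (P + 1)))); last first.
  rewrite mulrDr mulr1 lerD2l mulrCA ler_piMr ?(ltW e0)// ler_pdivrMr// mul1r.
  by rewrite lerDl.
have /cvgrPdist_lt /(_ _ e'0) [M _ MP] := u_cvg (f := f).
apply: cvgr_to_le L _; exists M => // N MN.
have E1 : \sum_(k < N) b k * u k.+1 f = \sum_(k < N) w k.+1 * u k.+1 f.
  by apply: eq_bigr => k _; rewrite bE.
have E2 : \sum_(k < N) `|b k| = \sum_(k < N) `|w k.+1|.
  by apply: eq_bigr => k _; rewrite bE.
rewrite E1 E2; apply: key => //; first exact: ltW.
by move=> k Nk; rewrite distrC ltW//; apply: MP; exact: leq_trans MN Nk.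
Qed.

(** By the decomposition the combination of t - w has norm at most c (P - |w|) in
X^*, where P is the dual norm of the combination of t; the lower bound turns
this into |t - w| <= P - |w|, so |t| <= P. *)
Lemma adapted_isometry t : `|SY t| = `|t|.
Proof.
apply/eqP; rewrite eq_le (combination_le adapted_family_le1) /=.
have [w wP] := adapted_decomposition t.
rewrite -(ler_pM2l c0).
have h : `|SX (t - w)| <= c * (`|SY t| - `|w|).
  apply: dual_norm_le1 => x x1; rewrite -ler_pdivrMl// lerBrDr.
  have := wP (c^-1 *: x); rewrite linearZ; apply.
  by rewrite normrZ normfV (gtr0_norm c0) mulVKf ?gt_eqF.
have := le_trans (SX_ge (t - w)) h; rewrite !ler_pM2l// => h'.
by rewrite -(subrK w t) (le_trans (ler_normD _ _))// -lerBrDr subrK.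
Qed.

End exact_renorming.

(** * A fixed point free isometry *)

Section shift.
Context {R : realType} {Y : normedModType R} (u : nat -> dual Y).
Hypothesis u1 : forall k, `|u k| <= 1.
Hypothesis u_cvg : forall y, u k.+1 y @[k --> \oo] --> u 0%N y.
Notation S := (combination u1).
Hypothesis S_iso : forall t, `|S t| = `|t|.

Definition simplex : set (ell1 R) := [set t : ell1 R | (forall k, 0 <= t k) /\ `|t| = 1].

(** On the simplex the coefficients sum to 1, so the combination differs from u 0
by a pairing with a sequence that tends to 0. *)
Lemma combination_simplex t y : simplex t ->
  S t y = u 0%N y + pairing t (fun k => u k y - u 0%N y).
Proof.
move=> [t0 t1].
have b1 : bounded_seq (fun=> 1 : R) 1 by move=> k; rewrite normr1.
have b2 : bounded_seq (fun k => u k y - u 0%N y) (`|y| + `|y|).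
  by move=> k; apply: le_trans (ler_normB _ _) _; apply: lerD; exact: eval_bounded.
rewrite combinationE.
have -> : (fun k => u k y) = (fun k => u 0%N y * 1 + (u k y - u 0%N y)).
  by apply/funext => k; rewrite mulr1 addrC subrK.
by rewrite (pairing_linr _ _ b1 b2) pairing_nonneg// t1 mulr1.
Qed.

Lemma pairing_c0_ultra (T : Type) (U : set_system T) (v : T -> ell1 R) (z : ell1 R)
    (psi : nat -> R) M :
  UltraFilter U -> (forall i, `|v i| <= 1) -> `|z| <= 1 ->
  (forall n, v i n @[i --> U] --> z n) -> bounded_seq psi M ->
  psi @ \oo --> (0 : R) ->
  pairing (v i) psi @[i --> U] --> pairing z psi.
Proof.
move=> UU v1 z1 vz psiM psi0; apply/cvgrPdist_lt => e e0.
have M0 : 0 <= M by apply: le_trans (psiM 0%N).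
have e40 : 0 < e / 4 by rewrite divr_gt0.
have /cvgrPdist_lt /(_ _ e40) [N _ NP] := psi0.
have c0 : `|trunc N (v i - z)| @[i --> U] --> (0 : R) by exact: ultra_trunc_cvg0.
have eM0 : 0 < e / 4 / (M + 1) by rewrite divr_gt0// ltr_wpDl.
have nr := cvgr_lt _ c0 _ eM0.
near=> i.
have wi : `|trunc N (v i - z)| < e / 4 / (M + 1) by near: i; exact: nr.
set w := v i - z in wi.
have -> : pairing z psi - pairing (v i) psi = - pairing w psi.
  have -> : w = -1 *: z + v i by rewrite scaleN1r addrC.
  by rewrite (pairing_linl _ _ _ psiM) mulN1r opprD opprK.
have w2 : `|w - trunc N w| <= 2.
  apply: le_trans (_ : `|w| <= _); first by rewrite -(norm_trunc_tail N w) lerDr.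
  by apply: le_trans (ler_normB _ _) _; rewrite -[leRHS]/(1 + 1) lerD.
have wE : w = 1 *: trunc N w + (w - trunc N w) by rewrite scale1r addrC subrK.
have tailw : `|pairing (w - trunc N w) psi| <= e / 4 * 2.
  pose psi' k : R := if (k < N)%N then 0 else psi k.
  have b' : bounded_seq psi' (e / 4).
    move=> k; rewrite /psi'; case: ltnP => kN; first by rewrite normr0 ltW.
    by have := NP k kN; rewrite /= sub0r normrN => /ltW.
  rewrite (_ : pairing _ psi = pairing (w - trunc N w) psi').
    by apply: le_trans (pairing_le _ b') _; rewrite ler_wpM2l// ltW.
  rewrite /pairing; congr (lim (_ @ \oo)); apply/funext => n; apply: eq_bigr => k _.
  by rewrite /psi' ell1B truncE; case: ltnP; rewrite ?subrr ?mul0r.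
have headw : `|pairing (trunc N w) psi| < e / 4.
  apply: le_lt_trans (pairing_le _ psiM) _.
  move: wi; rewrite ltr_pdivlMr ?ltr_wpDl//; apply: le_lt_trans.
  by rewrite mulrC ler_wpM2l// lerDl.
rewrite normrN wE (pairing_linl _ _ _ psiM) mul1r.
apply: le_lt_trans (ler_normD _ _) _.
move: headw tailw; move: `|_| `|_| => a b; lra.
Unshelve. all: by end_near. Qed.

(** The coordinatewise limit of elements of the simplex may lose mass; the lost
mass is put on the index 0, in accordance with the weak* convergence of u k
to u 0. *)
Lemma simplex_image_compact : compact (S @` simplex : set (wstar Y)).
Proof.
rewrite compact_ultra => U UU US.
have /choice[th thP] (g : dual Y) : exists t, simplex t /\ ((S @` simplex) g -> S t = g).
  have [[t tD <-]|n] := pselect ((S @` simplex) g); first by exists t.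
  exists (ell1_basis 0%N); split => //; split; last exact: norm_ell1_basis.
  by move=> k; rewrite ell1_basisE.
have th1 g : `|th g| <= 1 by have [[_ ->]] := thP g.
have [|z zth z1] := @ultra_coord_limit R (wstar Y) U UU th 1; first exact: filterE.
have z0 k : 0 <= z k.
  by apply: cvgr_to_ge (zth k) _; apply: filterE => g; have [[+ _] _] := thP g; apply.
pose x := z + (1 - `|z|) *: ell1_basis 0%N.
have sx : simplex x.
  split.
    move=> k; rewrite /x ell1D ell1Z ell1_basisE addr_ge0// mulr_ge0// ?subr_ge0//.
  have h : 0 <= 1 - `|z| by rewrite subr_ge0.
  rewrite /x norm_add_basis (ger0_norm (z0 0%N)) (ger0_norm (addr_ge0 (z0 0%N) h)).
  by ring.
exists (S x); split; first by exists x.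
have FU : Filter U by exact: (@filter_filter _ _ ultra_proper).
suff h : (id @ U : set_system (wstar Y)) --> (S x : wstar Y) by move=> A /h.
apply: (wstar_cvgP _ _ FU).2 => y.
rewrite (combination_simplex _ sx).
set eta := fun k => u k y - u 0%N y.
have etab : bounded_seq eta (`|y| + `|y|).
  by move=> k; apply: le_trans (ler_normB _ _) _; apply: lerD; exact: eval_bounded.
have eta0 : eta @ \oo --> (0 : R).
  have c : u k.+1 y - u 0%N y @[k --> \oo] --> (u 0%N y - u 0%N y : R).
    by apply: cvgB; [exact: u_cvg|exact: cvg_cst].
  by rewrite -cvg_shiftS; move: c; rewrite subrr; exact.
have -> : pairing x eta = pairing z eta.
  rewrite /x addrC (pairing_linl _ _ _ etab) (pairing_basis _ etab).
  by rewrite [eta 0%N]subrr mulr0 add0r.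
have c := pairing_c0_ultra UU th1 z1 zth etab eta0.
have {}c : u 0%N y + pairing (th g) eta @[g --> U] --> u 0%N y + pairing z eta.
  by apply: cvgD => //; exact: cvg_cst.
apply: cvg_trans c; apply: near_eq_cvg; apply: filterS US => g Cg.
by have [thD /(_ Cg) {2}<-] := thP g; rewrite combination_simplex.
Qed.

Lemma combinationZ (l : R) t : S (l *: t) = l *: S t.
Proof.
have S0 : S 0 = 0.
  by apply/eqP; rewrite -normr_eq0 S_iso normr0.
by rewrite -[l *: t]addr0 combination_lin S0 addr0.
Qed.

Lemma simplex_comb x y (t : R) : simplex x -> simplex y -> 0 <= t <= 1 ->
  simplex (t *: x + (1 - t) *: y).
Proof.
move=> [x0 x1] [y0 y1] /andP[t0 t1].
have c0 k : 0 <= (t *: x + (1 - t) *: y) k.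
  by rewrite ell1D !ell1Z addr_ge0// mulr_ge0// subr_ge0.
split => //; have b1 : bounded_seq (fun=> 1 : R) 1 by move=> k; rewrite normr1.
have p0 : pairing (0 : ell1 R) (fun=> 1) = 0.
  by rewrite pairing_nonneg ?normr0// => k; exact: lexx.
rewrite -pairing_nonneg// (pairing_linl _ _ _ b1) pairing_nonneg// x1 mulr1.
rewrite -[_ *: y]addr0 (pairing_linl _ _ _ b1) pairing_nonneg// y1 mulr1 p0.
by ring.
Qed.

(** A fixed point would be the combination of a vector of the simplex invariant
under the right shift of ell1, which only 0 is. *)
Theorem shifted_simplex_not_fpp : ~ wstar_fpp Y.
Proof.
move=> fY.
pose C := S @` simplex.
have C0 : C !=set0.
  exists (S (ell1_basis 0%N)), (ell1_basis 0%N) => //; split; last exact: norm_ell1_basis.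
  by move=> k; rewrite ell1_basisE.
have Ccvx : convex_set (C : set (convex_lmodType (dual Y))).
  move=> g h l; rewrite !inE => -[x sx <-] [y sy <-].
  exists (l%:num *: x + (1 - l%:num) *: y).
    by apply: simplex_comb => //; apply/andP; split.
  by rewrite combination_lin combinationZ.
have /choice[th thP] (g : dual Y) : exists t, C g -> simplex t /\ S t = g.
  have [[t tD <-]|n] := pselect (C g); first by exists t.
  by exists 0.
pose T g := S (ell1_cons 0 (th g)).
have [|g h Cg Ch|g Cg Tg] := fY C C0 Ccvx simplex_image_compact T.
- move=> g /thP[[t0 t1] _]; exists (ell1_cons 0 (th g)) => //; split.
    by case=> [|k]; rewrite ell1_consE.
  by rewrite norm_ell1_cons normr0 add0r.
- have [_ gE] := thP g Cg; have [_ hE] := thP h Ch.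
  rewrite -{2}gE -{2}hE /T -!combinationB !S_iso.
  have -> : ell1_cons 0 (th g) - ell1_cons 0 (th h) = ell1_cons 0 (th g - th h).
    by apply: ell1P => -[|k]; rewrite ell1B !ell1_consE ?subrr// ell1B.
  by rewrite norm_ell1_cons normr0 add0r.
have [[t0 t1] gE] := thP g Cg.
have tE : ell1_cons 0 (th g) = th g.
  apply/eqP; rewrite -subr_eq0 -normr_eq0 -S_iso combinationB.
  by rewrite gE -/(T g) Tg subrr normr0.
have : th g = 0.
  apply: ell1P; elim=> [|k IH]; first by rewrite -tE ell1_consE.
  by rewrite -tE ell1_consE IH.
by move=> t00; move: t1; rewrite t00 normr0 => /eqP; rewrite eq_sym oner_eq0.
Qed.

End shift.

(** * Limit points from stability *)

Lemma bounded_linear_opnorm (R : realType) (V W : normedModType R)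
    (f : {linear V -> W}) (M : R) : 0 <= M -> (forall x, `|f x| <= M * `|x|) ->
  continuous f /\ opnorm f <= M.
Proof.
move=> M0 fM; split; last exact: opnorm_le.
apply: bounded_linear_continuous; apply: (bounded_funP f).1 => r; exists (M * r) => x xr.
by apply: le_trans (fM x) _; rewrite ler_wpM2l.
Qed.

Lemma banach_mazur_renormed (R : realType) (X : completeNormedModType R) (p : renorming X) :
  (banach_mazur X (renormed p) <= ((renorm_ratio p)^-1)%:E)%E.
Proof.
have c0 := renorm_ratio_gt0 p.
have linA : linear (id : X -> renormed p) by [].
have linB : linear (id : renormed p -> X) by [].
pose A : {linear X -> renormed p} :=
  HB.pack (id : X -> renormed p) (GRing.isLinear.Build _ _ _ _ _ linA).
pose B : {linear renormed p -> X} :=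
  HB.pack (id : renormed p -> X) (GRing.isLinear.Build _ _ _ _ _ linB).
have [|cA A1] := @bounded_linear_opnorm R X (renormed p) A 1 ler01.
  by move=> x; rewrite mul1r; exact: renorm_le.
have [||cB B1] := @bounded_linear_opnorm R (renormed p) X B (renorm_ratio p)^-1.
- by rewrite invr_ge0 ltW.
- by move=> x; rewrite ler_pdivlMl//; exact: renorm_ge.
apply: (@le_trans _ _ (opnorm A * opnorm B)%:E).
  by apply: ereal_inf_lbound; exists A, B; split.
by rewrite lee_fin -[leRHS]mul1r ler_pM// opnorm_ge0.
Qed.

(** A limit point of norm close to 1 yields spaces arbitrarily close to X whose dual
fails the weak* fixed point property. *)
Lemma stable_limit_points (R : realType) (X : completeNormedModType R)
    (J : {linear ell1 R -> dual X}) (HJ : isometric_iso J) :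
  stable_wstar_fpp X ->
  exists2 r : R, 0 <= r < 1 &
    limit_point (ext (unit_ball (ell1 R)) : set (sigma_ell1 J)) `<=`
      [set r *: a | a in unit_ball (ell1 R)].
Proof.
move=> [gamma gamma1 st].
have g0 : 0 < gamma by apply: lt_trans gamma1.
have gV1 : gamma^-1 < 1 by rewrite invf_lt1.
have gV0 : 0 < gamma^-1 by rewrite invr_gt0.
(* The renorming below is at distance at most (1 - 3 eps)^-1 from X, and this
   choice of eps keeps it below gamma. *)
pose eps : R := (1 - gamma^-1) / 6.
have eps0 : 0 < eps by rewrite /eps; move: gV1; lra.
have eps1 : 6 * eps < 1 by rewrite /eps; move: gV0; lra.
have cg : gamma^-1 < 1 - 3 * eps by rewrite /eps; move: gV1; lra.
exists (1 - eps); first by apply/andP; split; lra.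
move=> x0 lp.
suff x0r : `|x0| <= 1 - eps.
  have r0 : 0 < 1 - eps by lra.
  exists ((1 - eps)^-1 *: x0); last by rewrite scalerA mulfV ?scale1r// gt_eqF.
  by rewrite /unit_ball /= normrZ normfV (gtr0_norm r0) ler_pdivrMl// mulr1.
rewrite leNgt; apply/negP => /ltW x0_ge.
have [s [n [s1 n_incr x0_small x0_cvg]]] := extremal_sequence HJ eps0 lp.
have x0_le : `|x0| <= 1.
  rewrite -(normJ HJ); apply: dual_norm_le => // f; rewrite mul1r.
  have c : `|J (s k *: ell1_basis (n k)) f| @[k --> \oo] --> `|J x0 f|.
    by apply: (@cvg_norm _ R^o); exact: x0_cvg.
  apply: cvgr_to_le c _; apply: filterE => k; apply: le_trans (J_apply_le HJ _ _) _.
  by rewrite normrZ norm_ell1_basis s1 !mul1r.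
have c0 : 0 < 1 - 3 * eps by lra.
have c1 : 1 - 3 * eps <= 1 by lra.
pose u1 := extremal_family_le1 HJ n s1 x0_le.
have u_cvg f : extremal_family J x0 s n k.+1 f @[k --> \oo] --> extremal_family J x0 s n 0%N f.
  exact: x0_cvg.
have low t : (1 - 3 * eps) * `|t| <= `|combination u1 t|.
  by apply: (combination_lower_bound HJ eps0 x0_ge s1 n_incr x0_small x0_le); lra.
pose p := adapted_renorming u1 c0 c1.
have iso := adapted_isometry u_cvg c0 c1 low.
apply: (@shifted_simplex_not_fpp R (renormed p) (adapted_family u1 c0 c1) _ _ iso).
  by move=> y; under eq_fun do rewrite adapted_familyE; rewrite adapted_familyE; exact: u_cvg.
apply: st; apply: le_lt_trans (banach_mazur_renormed p) _.
by rewrite lte_fin /= invf_plt ?posrE.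
Qed.

(** * The equivalence *)

Theorem theorem3p4 (R : realType) (X : completeNormedModType R)
    (J : {linear ell1 R -> dual X}) (HJ : isometric_iso J) :
  stable_wstar_fpp X <->
  exists2 r : R, 0 <= r < 1 &
    limit_point (ext (unit_ball (ell1 R)) : set (sigma_ell1 J)) `<=`
      [set r *: a | a in unit_ball (ell1 R)].
Proof.
split; first exact: stable_limit_points HJ.
by move=> [r r01 lp]; exact: (limit_points_stable HJ r01 lp).
Qed.
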